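(* Let $Y$ be the bounded strong solution of the (capped) call-side obstacle problem with free boundaries $$A(\tau)=\max\{x\le\ln K_1:Y(x,\tau)=K_2-k_1\},\quad B(\tau)=\min\{x\in[\ln K_1,\ln k_1]:Y(x,\tau)=\psi_1(x)\},\quad\tau\in(0,T],$$ and let $Y^\infty$ be the strong solution of the uncapped call-side obstacle problem, with $$B^\infty(\tau):=\inf\{x\ge\ln K_1:Y^\infty(x,\tau)=\psi_1(x)\}\in[\ln K_1,+\infty],\qquad\inf\emptyset:=+\infty .$$ Then: (i) $Y\le Y^\infty$ on $(-\infty,\ln k_1]\times[0,T]$. (ii) $B(\tau)=\min\{B^\infty(\tau),\ \ln k_1\}$ for every $\tau\in(0,T]$. (iii) Let $\tau^*:=\sup\{\tau\in(0,T]:B^\infty(\tau)\le\ln k_1\}$, with $\tau^*:=0$ if this set is empty. Then $Y=Y^\infty$ on $(-\infty,\ln k_1]\times[0,\tau^*]$. In particular, on $[0,\tau^*]$ the lower free boundary $A$ coincides with the lower free boundary $$A^\infty(\tau):=\max\{x\le\ln K_1:Y^\infty(x,\tau)=K_2-k_1\}$$ of the uncapped problem, and $A^\infty(\tau)\le A(\tau)$ for all $\tau\in(0,T]$.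
   Context: Constants: $0<K_1<k_1<k_2<K_2$, $\sigma>0$, $r>0$, $q\ge0$, $T>0$. Put $\mathcal Lu:=\frac{\sigma^2}{2}\partial_{xx}u+\left(r-q-\frac{\sigma^2}{2}\right)\partial_xu-ru$ and $\psi_1(x):=(e^x-K_1)^++K_2-k_1$. For $I=(-\infty,\ln k_1)$ or $I=\mathbb R$, $Q=I\times(0,T]$ and $1<p<\infty$, $\mathcal W_p(Q)$ is the set of $u\in C(\overline I\times[0,T])$ such that, for all $R,\rho>0$, $u,\partial_xu,\partial_{xx}u,\partial_\tau u$ (weak derivatives) belong to $L^p$ of $\left((I\cap(-R,R))\times(0,T)\right)\setminus B_\rho(\ln K_1,0)$, where $B_\rho$ denotes an open disc of radius $\rho$. A strong solution of the capped ($I=(-\infty,\ln k_1)$) or uncapped ($I=\mathbb R$) call-side obstacle problem is a function $u\in\mathcal W_p(Q)$ with $u\ge\psi_1$ in $Q$, $\partial_\tau u-\mathcal Lu\ge0$ almost everywhere in $Q$, $\partial_\tau u-\mathcal Lu=0$ almost everywhere on $\{u>\psi_1\}$, $u(x,0)=\psi_1(x)$ for $x\in I$, and, in the capped case only, $u(\ln k_1,\tau)=K_2-K_1$ for $\tau\in[0,T]$. For every $1<p<\infty$ the capped problem has exactly one bounded strong solution $Y$ and the uncapped problem has exactly one strong solution $Y^\infty$ with $|Y^\infty|\le Ce^{|x|}$ for some constant $C$; they do not depend on $p$. The values of $A$ and $A^\infty$ at $\tau=0$ are understood as limits $\tau\searrow0$. The max and min defining $A(\tau)$ and $B(\tau)$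 are attained for every $\tau\in(0,T]$. *)

(* Defs.v *)
From HB Require Import structures.
From mathcomp Require Export all_boot all_order all_algebra.
From mathcomp Require Export all_classical all_reals all_analysis.

Set Implicit Arguments.
Unset Strict Implicit.
Unset Printing Implicit Defensive.

Export Order.TTheory GRing.Theory Num.Theory.
Export numFieldNormedType.Exports.

Local Open Scope classical_set_scope.
Local Open Scope ring_scope.

(* Points of the (space, time) plane are pairs z = (x, tau) : R * R. *)

Definition lebesgue2 (R : realType) :
    {measure set (measurableTypeR R * measurableTypeR R) -> \bar R} :=
  ((@lebesgue_measure R) \x (@lebesgue_measure R))%E.
Arguments lebesgue2 R : clear implicits.

Definition partial_x (R : realType) (f : R * R -> R) : R * R -> R :=
  'D_((1, 0) : R * R) f.

Definition partial_t (R : realType) (f : R * R -> R) : R * R -> R :=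
  'D_((0, 1) : R * R) f.

Fixpoint Ck (R : realType) (n : nat) (f : R * R -> R) : Prop :=
  if n is m.+1 then
    [/\ forall z, derivable f z ((1, 0) : R * R),
        forall z, derivable f z ((0, 1) : R * R),
        Ck m (partial_x f) &
        Ck m (partial_t f)]
  else continuous f.

Definition test_function (R : realType) (Omega : set (R * R))
    (phi : R * R -> R) : Prop :=
  [/\ forall n, Ck n phi,
      compact (closure [set z | phi z != 0]) &
      closure [set z | phi z != 0] `<=` Omega].

Definition L1loc (R : realType) (Omega : set (R * R)) (v : R * R -> R) : Prop :=
  forall K : set (R * R), compact K -> K `<=` Omega ->
    (lebesgue2 R).-integrable K (EFin \o v).

(* v is the weak derivative d_x^i d_tau^j u on the open set Omega. *)
Definition weak_derivative (R : realType) (Omega : set (R * R)) (i j : nat)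
    (u v : R * R -> R) : Prop :=
  [/\ L1loc Omega u, L1loc Omega v &
      forall phi, test_function Omega phi ->
        \int[lebesgue2 R]_(z in Omega)
           (u z * iter i (@partial_x R) (iter j (@partial_t R) phi) z) =
        (-1) ^+ (i + j) * \int[lebesgue2 R]_(z in Omega) (v z * phi z)].

Definition Lp_on (R : realType) (p : R) (D : set (R * R)) (f : R * R -> R) :
    Prop :=
  f \_ D \in Lfun (lebesgue2 R) p%:E.

Definition disc (R : realType) (z0 : R * R) (rho : R) : set (R * R) :=
  [set z | (z.1 - z0.1) ^+ 2 + (z.2 - z0.2) ^+ 2 < rho ^+ 2].

(* Membership of u in W_p(I x (0,T]) with singular point (a, 0); the witnesses
   ux, uxx, ut (unique up to a null set) are the weak derivatives of u on the
   open rectangle I x (0,T), which does not contain (a, 0).  Only the values of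
   u on closure I x [0,T] matter. *)
Definition Wp_with (R : realType) (p T a : R) (I : set R)
    (u ux uxx ut : R * R -> R) : Prop :=
  [/\ {within closure I `*` `[0, T], continuous u},
      weak_derivative (I `*` `]0, T[) 1 0 u ux,
      weak_derivative (I `*` `]0, T[) 2 0 u uxx,
      weak_derivative (I `*` `]0, T[) 0 1 u ut &
      forall M rho : R, 0 < M -> 0 < rho ->
        let D := ((I `&` `]- M, M[) `*` `]0, T[) `\` disc (a, 0) rho in
        [/\ Lp_on p D u, Lp_on p D ux, Lp_on p D uxx & Lp_on p D ut]].

Definition psi1 (R : realType) (K1 k1 K2 x : R) : R :=
  Num.max (expR x - K1) 0 + K2 - k1.

Definition strong_solution (R : realType) (K1 k1 K2 sigma r q T p : R)
    (I : set R) (u : R * R -> R) : Prop :=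
  let Q := I `*` `]0, T] in
  exists ux uxx ut : R * R -> R,
    let L z := sigma ^+ 2 / 2 * uxx z
               + (r - q - sigma ^+ 2 / 2) * ux z - r * u z in
    [/\ Wp_with p T (ln K1) I u ux uxx ut,
        forall z, Q z -> psi1 K1 k1 K2 z.1 <= u z,
        {ae lebesgue2 R, forall z, Q z -> 0 <= ut z - L z},
        {ae lebesgue2 R, forall z, Q z -> psi1 K1 k1 K2 z.1 < u z ->
           ut z - L z = 0} &
        forall x, I x -> u (x, 0) = psi1 K1 k1 K2 x].

Definition capped_strong_solution (R : realType)
    (K1 k1 K2 sigma r q T p : R) (u : R * R -> R) : Prop :=
  strong_solution K1 k1 K2 sigma r q T p `]-oo, ln k1[ u /\
  forall t, 0 <= t <= T -> u (ln k1, t) = K2 - K1.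

Definition uncapped_strong_solution (R : realType)
    (K1 k1 K2 sigma r q T p : R) (u : R * R -> R) : Prop :=
  strong_solution K1 k1 K2 sigma r q T p [set: R] u.

Definition is_max (R : realType) (S : set R) (m : R) : Prop :=
  S m /\ ubound S m.

Definition is_min (R : realType) (S : set R) (m : R) : Prop :=
  S m /\ lbound S m.

(* The value at tau = 0 is the limit tau \searrow 0. *)
Definition lower_free_boundary (R : realType) (K1 k1 K2 T : R)
    (u : R * R -> R) (A : R -> R) : Prop :=
  (forall t, 0 < t <= T ->
     is_max [set x | x <= ln K1 /\ u (x, t) = K2 - k1] (A t)) /\
  A t @[t --> (0 : R)^'+] --> A 0.

Definition capped_upper_free_boundary (R : realType) (K1 k1 K2 T : R)
    (u : R * R -> R) (B : R -> R) : Prop :=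
  forall t, 0 < t <= T ->
    is_min [set x | ln K1 <= x <= ln k1 /\ u (x, t) = psi1 K1 k1 K2 x] (B t).

(* ereal_inf set0 = +oo *)
Definition uncapped_upper_free_boundary (R : realType) (K1 k1 K2 : R)
    (u : R * R -> R) (t : R) : \bar R :=
  ereal_inf
    (EFin @` [set x | ln K1 <= x /\ u (x, t) = psi1 K1 k1 K2 x]).

(* sup set0 = 0 in the library; the set is bounded by T. *)
Definition tau_star (R : realType) (k1 T : R) (Binf : R -> \bar R) : R :=
  sup [set t | 0 < t <= T /\ (Binf t <= (ln k1)%:E)%E].

(* Main.v *)
(** With [p > 1] arbitrary, strong solutions need not be classical, so comparison is obtained by
    mollification.  Near every point a weak subsolution is a uniform limit of smooth functions
    that are subsolutions up to an arbitrarily small error; sums and translates inherit this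
    property, and it yields the viscosity inequality at a local maximum of [w - F] with [F]
    smooth.  The barrier [(e^(2x) + e^(-2x)) e^(la t) + 1 / (T - t)] turns this into a comparison
    principle for the difference of two solutions.

    Comparing [Y] with [Yinf] gives (i).  Comparing a solution with its time translates shows
    that it increases in time; comparing [u (x + h, t)] with [u (x, t) + e^x (e^h - 1)] shows that
    contact with the obstacle at [(x, t)], [x >= ln K1], propagates to the right, and by
    monotonicity to earlier times.  If [Y] touches the obstacle at [x0 < ln k1], then [Y] continued
    by the obstacle beyond [ln k1] is a supersolution of the uncapped problem, so [Yinf] touches
    at [x0] as well: this is (ii).  As long as [Binf <= ln k1], [Yinf] takes the capped boundary
    value at [ln k1], hence [Yinf <= Y]: this is (iii).  A quadratic barrier shows that the lower
    contact set of [Yinf] is nonempty at every time and that both lower boundaries tend to [ln K1]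
    as [t] decreases to 0. *)
Require Import Defs.
From mathcomp Require Import measurable_realfun ring lra.
Set Implicit Arguments.
Unset Strict Implicit.
Unset Printing Implicit Defensive.
Local Open Scope classical_set_scope.
Local Open Scope ring_scope.

(** * A smooth bump function *)

(** Mollification works here because the coefficients are constant: it commutes with the operator,
    so that a sign valid almost everywhere becomes a sign at every point, while uniform closeness
    needs only the continuity of the solution. The obstacle problem is nonlinear, but where [u > v]
    one has [u > v >= psi], so [u] satisfies the equation there and [v] is a supersolution; hence
    comparison has to test [u - v] only where it is positive. With a = sigma^2 / 2 and b = r - q -
    sigma^2 / 2 one has a + b = r - q, so q >= 0 says that e^x is a supersolution. This one sign
    serves twice: space translates can be compared after adding a multiple of e^x, and -L(e^x + k) =
    r k + (r - a - b) e^x is nondecreasing in x. In the barrier, the exponent 2 beats the growth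
    e^|x|, and 1 / (T - t) keeps maxima away from the final time, around which no full neighbourhood
    is available. *)

Fixpoint smoothn (R : realType) (n : nat) (f : R -> R) : Prop :=
  if n is m.+1 then (forall x, derivable f x 1) /\ smoothn m (f^`())%classic
  else True.

Definition smooth (R : realType) (f : R -> R) := forall n, smoothn n f.

Lemma smooth_derivable (R : realType) (f : R -> R) :
  smooth f -> forall x, derivable f x 1.
Proof. by move=> /(_ 1%N) []. Qed.

Lemma smooth_derive1 (R : realType) (f : R -> R) :
  smooth f -> smooth (f^`())%classic.
Proof. by move=> sf n; have [] := sf n.+1. Qed.

Lemma smooth_is_derive (R : realType) (f : R -> R) :
  smooth f -> forall x : R, is_derive x (1 : R) f ((f^`())%classic x).
Proof.
move=> sf x; rewrite derive1E; apply: DeriveDef => //; exact: smooth_derivable.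
Qed.

Lemma smooth_continuous (R : realType) (f : R -> R) : smooth f -> continuous f.
Proof.
move=> sf x; apply/differentiable_continuous/derivable1_diffP.
exact: smooth_derivable.
Qed.

Lemma smoothnS (R : realType) n (f : R -> R) : smoothn n.+1 f -> smoothn n f.
Proof.
elim: n f => [//|n IH] f /= [df] sf; split=> //; exact: (IH _ sf).
Qed.

Lemma smoothnD (R : realType) n (f g : R -> R) :
  smoothn n f -> smoothn n g -> smoothn n (fun x => f x + g x).
Proof.
elim: n f g => [//|n IH] f g /= [df sf] [dg sg]; split.
  by move=> x; exact: derivableD.
rewrite (_ : (fun x => f x + g x)^`()%classic =
  (fun x => (f^`())%classic x + (g^`())%classic x)); first exact: IH.
by apply/funext => x; rewrite !derive1E deriveD.
Qed.

Lemma smoothnM (R : realType) n (f g : R -> R) :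
  smoothn n f -> smoothn n g -> smoothn n (fun x => f x * g x).
Proof.
elim: n f g => [//|n IH] f g /= [df sf] [dg sg]; split.
  by move=> x; exact: derivableM.
rewrite (_ : (fun x => f x * g x)^`()%classic =
  (fun x => f x * (g^`())%classic x + g x * (f^`())%classic x)).
  apply: smoothnD; apply: IH => //; exact: smoothnS.
by apply/funext => x; rewrite !derive1E deriveM.
Qed.

Lemma smoothn_affine (R : realType) n (k l : R) (f : R -> R) :
  smoothn n f -> smoothn n (fun x => f (k * x + l)).
Proof.
elim: n f => [//|n IH] f /= [df sf].
have H (x : R) : is_derive x 1 (fun x : R => f (k * x + l)) (k * (f^`())%classic (k * x + l)).
  have d1 : is_derive (k * x + l) 1 f ((f^`())%classic (k * x + l)).
    by rewrite derive1E; exact: DeriveDef.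
  have d2 : is_derive x 1 (fun x : R => k * x + l) k.
    by apply: is_derive_eq; rewrite addr0 /GRing.scale /= mulr1.
  have := @is_derive1_comp R f (fun x : R => k * x + l) x _ _ d1 d2.
  by move/is_derive_eq; apply; rewrite /GRing.scale /= mulrC.
split; first by move=> x; have [] := H x.
rewrite (_ : (fun x => f (k * x + l))^`()%classic =
  (fun x => (fun=> k) x * (f^`())%classic (k * x + l))).
  apply: smoothnM; last exact: IH.
  by elim: n {IH df sf H} (k) => [//|n IH] c /=; split => //;
    rewrite (_ : _^`()%classic = cst 0); [exact: IH|
    apply/funext => x; rewrite derive1E derive_cst].
by apply/funext => x; rewrite derive1E; have [_ ->] := H x.
Qed.

(** The rate [k] is left free so that the induction can halve it: one half absorbs [P], the other
    the new factor y, by 1 + z <= e^z. *)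
Lemma horner_le_expR (R : realType) (P : {poly R}) (k : R) : 0 < k ->
  exists C : R, forall y, 0 <= y -> `|P.[y]| <= C * expR (k * y).
Proof.
elim/poly_ind: P k => [|P c IH] k k0.
  by exists 0 => y _; rewrite horner0 normr0 mul0r.
have k2 : 0 < k / 2 by lra.
have [C HC] := IH _ k2.
exists (C * (k / 2)^-1 + `|c|) => y y0.
rewrite hornerMXaddC mulrDl (le_trans (ler_normD _ _))//.
have e1 : 1 <= expR (k * y) by rewrite -expR0 ler_expR; apply: mulr_ge0 => //; lra.
have -> : k * y = k / 2 * y + k / 2 * y by lra.
rewrite expRD lerD//; last first.
  rewrite -expRD ler_peMr//.
  by have -> : k / 2 * y + k / 2 * y = k * y by lra.
rewrite normrM (ger0_norm y0).
have -> : C / (k / 2) * (expR (k / 2 * y) * expR (k / 2 * y)) =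
  (C * expR (k / 2 * y)) * ((k / 2)^-1 * expR (k / 2 * y)) by ring.
apply: ler_pM => //; first exact: HC.
rewrite -ler_pdivrMl ?invr_gt0// invrK.
by rewrite (le_trans _ (expR_ge1Dx _))// lerDr.
Qed.

(** With y = 1/x, d/dx acts as -y^2 d/dy and sends P(y) e^(-y) to y^2 (P - P')(y) e^(-y): carrying a
    polynomial makes the family stable under differentiation, and smoothness becomes an
    induction. *)
Definition flat (R : realType) (P : {poly R}) (x : R) : R :=
  if 0 < x then P.[x^-1] * expR (- x^-1) else 0.

Lemma is_derive_flat (R : realType) (P : {poly R}) (x : R) :
  is_derive x 1 (flat P) (flat ('X^2 * (P - P^`())) x).
Proof.
case: (ltgtP x 0) => x0.
- apply: (@near_eq_is_derive _ _ _ (cst 0)).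
  + near=> y; rewrite /flat ifF//; apply/negbTE; rewrite -leNgt; apply/ltW.
    by near: y; apply: lt_nbhsl.
  + by rewrite /flat ifF; [exact: is_derive_cst|apply/negbTE; rewrite -leNgt ltW].
- apply: (@near_eq_is_derive _ R R (fun x : R => P.[x^-1] * expR (- x^-1))).
  + near=> y; rewrite /flat ifT//.
    by near: y; apply: lt_nbhsr.
  + have d1 : is_derive x 1 (fun x : R => x^-1) (- x ^- 2).
      have xn0 : x != 0 by rewrite gt_eqF.
      have := @is_deriveV R (@id R) x 1 1 xn0 (is_derive_id x 1); move/is_derive_eq; apply.
      by rewrite /GRing.scale /= mulr1.
    rewrite /flat x0.
    have d2 := @is_derive1_comp R (horner P) (fun x : R => x^-1) x _ _ (is_derive_poly P x^-1) d1.
    have d3 := @is_derive1_comp R expR (fun x : R => - x^-1) x _ _ (is_derive_expR (- x^-1)) (is_deriveN d1).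
    have := is_deriveM d2 d3; move/is_derive_eq; apply.
    rewrite /GRing.scale /= hornerM hornerXn hornerD hornerN.
    rewrite exprVn; set A := expR _; set B := P.[_]; set C := P^`().[_]; set D := x ^- 2.
    ring.
- rewrite x0 (_ : flat ('X^2 * (P - P^`())) 0 = 0); last by rewrite /flat ltxx.
  (* The bound is taken two degrees above [P], so that the quotient P(1/h) e^(-1/h) / h is at most a
     constant times h. *)
  have [C HC] := horner_le_expR ('X^2 * P) (ltr01).
  have H : (h^-1 *: (flat P (h *: 1 + 0) - flat P 0)) @[h --> (0:R)^'] --> (0 : R).
    apply/cvgr0Pnorm_le => e e0; near=> h.
    rewrite /flat ltxx subr0 addr0 /GRing.scale /= mulr1.
    case: ifPn => h0; last by rewrite mulr0 normr0 ltW.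
    rewrite normrM (gtr0_norm (_ : 0 < h^-1)) ?invr_gt0// normrM.
    rewrite (gtr0_norm (expR_gt0 _)).
    have hV0 : 0 <= h^-1 by rewrite invr_ge0 ltW.
    have := HC _ hV0; rewrite hornerM hornerXn mul1r normrM normrX (ger0_norm hV0) => H1.
    have E : h^-1 * (`|P.[h^-1]| * expR (- h^-1)) =
      h * (h^-1 ^+ 2 * `|P.[h^-1]| * expR (- h^-1)).
      by field; rewrite gt_eqF.
    rewrite E.
    have H2 : h^-1 ^+ 2 * `|P.[h^-1]| * expR (- h^-1) <= C.
      by rewrite expRN ler_pdivrMr ?expR_gt0.
    have C0 : 0 < `|C| + 1 by rewrite ltr_wpDl.
    apply: (@le_trans _ _ (h * (`|C| + 1))).
      rewrite ler_pM2l// (le_trans H2)// (le_trans (ler_norm C))//; lra.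
    rewrite -ler_pdivlMr//.
    apply: le_trans (ler_norm h) _.
    by near: h; apply: dnbhs0_le; apply: divr_gt0.
  apply: DeriveDef; first exact: cvgP H.
  exact: cvg_lim H.
Unshelve. all: by end_near. Qed.

Lemma smooth_flat (R : realType) (P : {poly R}) : smooth (flat P).
Proof.
move=> n; elim: n P => [//|n IH] P /=; split.
  by move=> x; have [] := is_derive_flat P x.
rewrite (_ : (flat P)^`()%classic = flat ('X^2 * (P - P^`()))); first exact: IH.
by apply/funext => x; rewrite derive1E; have [_ ->] := is_derive_flat P x.
Qed.

(** Equal to exp(-2 / (1 - x^2)) on (-1, 1) and to 0 elsewhere; the arguments have the form
    [k * x + l] of [smoothn_affine]. *)
Definition bump (R : realType) (x : R) : R := flat 1 (1 * x + 1) * flat 1 (-1 * x + 1).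

Lemma smooth_bump (R : realType) : smooth (@bump R).
Proof.
by move=> n; apply: smoothnM; apply: smoothn_affine; exact: smooth_flat.
Qed.

Lemma flat1_ge0 (R : realType) (x : R) : 0 <= flat 1 x.
Proof. by rewrite /flat; case: ifP => // _; rewrite hornerC mul1r expR_ge0. Qed.

Lemma flat1_gt0 (R : realType) (x : R) : 0 < x -> 0 < flat 1 x.
Proof. by move=> x0; rewrite /flat x0 hornerC mul1r expR_gt0. Qed.

Lemma bump_ge0 (R : realType) (x : R) : 0 <= bump x.
Proof. by apply: mulr_ge0; exact: flat1_ge0. Qed.

Lemma bump0_gt0 (R : realType) : 0 < bump (0 : R).
Proof. by rewrite /bump !mulr0 !add0r; apply: mulr_gt0; exact: flat1_gt0. Qed.

Lemma bump_eq0 (R : realType) (x : R) : 1 <= `|x| -> bump x = 0.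
Proof.
move=> x1; rewrite /bump /flat; case: ifPn => h1; last by rewrite mul0r.
case: ifPn => h2; last by rewrite mulr0.
by exfalso; move: x1; rewrite ler_normr => /orP[]; lra.
Qed.

(** * Approximate classical subsolutions *)

(** The derivatives are explicit functions so that sums and translates act on them directly. Their
    continuity is not included: [viscosity_subsol] asks it of the test function, at [z0] only. *)
Definition classical (R : realType) (N : set (R * R)) (U Ut Ux Uxx : R * R -> R) :=
  forall z, N z ->
  [/\ {for z, continuous U},
      is_derive z.2 (1 : R) (fun t : R => U (z.1, t)) (Ut z),
      is_derive z.1 (1 : R) (fun x : R => U (x, z.2)) (Ux z) &
      is_derive z.1 (1 : R) (fun x : R => Ux (x, z.2)) (Uxx z)].

(** Local uniform approximation by functions that are classical subsolutions up to an
    arbitrarily small error: unlike the viscosity inequality, this is stable under sums. *)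
Definition subsol (R : realType) (a b r : R) (w : R * R -> R) (z0 : R * R) :=
  exists2 d : R, 0 < d & forall eps : R, 0 < eps ->
  exists U Ut Ux Uxx : R * R -> R,
  [/\ classical (ball z0 d) U Ut Ux Uxx,
      forall z : R * R, ball z0 d z -> `|U z - w z| <= eps &
      forall z : R * R, ball z0 d z -> Ut z - (a * Uxx z + b * Ux z - r * U z) <= eps].

(** [F] touches [w] only up to an additive constant, hence [w z0] and not [F z0] in the zeroth-order
    term. *)
Definition viscosity_subsol (R : realType) (a b r : R) (w : R * R -> R) (z0 : R * R) :=
  forall (d : R) (F Ft Fx Fxx : R * R -> R), 0 < d ->
  classical (ball z0 d) F Ft Fx Fxx ->
  {for z0, continuous Ft} -> {for z0, continuous Fx} -> {for z0, continuous Fxx} ->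
  (forall z : R * R, ball z0 d z -> w z - F z <= w z0 - F z0) ->
  Ft z0 - (a * Fxx z0 + b * Fx z0 - r * w z0) <= 0.

Lemma ball_prodE (R : realType) (z0 z : R * R) (d : R) :
  ball z0 d z <-> `|z0.1 - z.1| < d /\ `|z0.2 - z.2| < d.
Proof. by []. Qed.

Lemma classicalW (R : realType) (N N' : set (R * R)) (U Ut Ux Uxx : R * R -> R) :
  N' `<=` N -> classical N U Ut Ux Uxx -> classical N' U Ut Ux Uxx.
Proof. by move=> NN H z /NN /H. Qed.

Lemma classicalD (R : realType) (N : set (R * R)) (U Ut Ux Uxx V Vt Vx Vxx : R * R -> R) :
  classical N U Ut Ux Uxx -> classical N V Vt Vx Vxx ->
  classical N (fun z => U z + V z) (fun z => Ut z + Vt z) (fun z => Ux z + Vx z)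
    (fun z => Uxx z + Vxx z).
Proof.
move=> HU HV z Nz; have [cU Ut' Ux' Uxx'] := HU _ Nz; have [cV Vt' Vx' Vxx'] := HV _ Nz.
split; [exact: cvgD|exact: is_deriveD|exact: is_deriveD|exact: is_deriveD].
Qed.

Lemma classicalN (R : realType) (N : set (R * R)) (U Ut Ux Uxx : R * R -> R) :
  classical N U Ut Ux Uxx ->
  classical N (fun z => - U z) (fun z => - Ut z) (fun z => - Ux z) (fun z => - Uxx z).
Proof.
move=> HU z Nz; have [cU Ut' Ux' Uxx'] := HU _ Nz.
split; [exact: cvgN|exact: is_deriveN|exact: is_deriveN|exact: is_deriveN].
Qed.

Lemma subsolD (R : realType) (a b r : R) (u v : R * R -> R) (z0 : R * R) :
  subsol a b r u z0 -> subsol a b r v z0 -> subsol a b r (fun z => u z + v z) z0.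
Proof.
move=> [d d0 Hu] [d' d'0 Hv]; exists (Num.min d d'); first by rewrite lt_min d0 d'0.
move=> e e0; have e2 : 0 < e / 2 by lra.
have [U [Ut [Ux [Uxx [cU HU SU]]]]] := Hu _ e2.
have [V [Vt [Vx [Vxx [cV HV SV]]]]] := Hv _ e2.
have sd : ball z0 (Num.min d d') `<=` ball z0 d.
  by apply: le_ball; rewrite ge_min lexx.
have sd' : ball z0 (Num.min d d') `<=` ball z0 d'.
  by apply: le_ball; rewrite ge_min lexx orbT.
exists (fun z => U z + V z), (fun z => Ut z + Vt z), (fun z => Ux z + Vx z),
    (fun z => Uxx z + Vxx z); split.
- exact: classicalD (classicalW sd cU) (classicalW sd' cV).
- move=> z zb; rewrite opprD addrACA (le_trans (ler_normD _ _))// [leRHS](splitr e).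
  by apply: lerD; [exact/HU/sd|exact/HV/sd'].
- move=> z zb; have := SU _ (sd _ zb); have := SV _ (sd' _ zb); lra.
Qed.

Lemma subsol_near (R : realType) (a b r : R) (u v : R * R -> R) (z0 : R * R) (d : R) :
  0 < d -> (forall z : R * R, ball z0 d z -> u z = v z) ->
  subsol a b r u z0 -> subsol a b r v z0.
Proof.
move=> d0 uv [d' d'0 Hu]; exists (Num.min d d'); first by rewrite lt_min d0 d'0.
have sd : ball z0 (Num.min d d') `<=` ball z0 d.
  by apply: le_ball; rewrite ge_min lexx.
have sd' : ball z0 (Num.min d d') `<=` ball z0 d'.
  by apply: le_ball; rewrite ge_min lexx orbT.
move=> e e0; have [U [Ut [Ux [Uxx [cU HU SU]]]]] := Hu _ e0.
exists U, Ut, Ux, Uxx; split; first exact: classicalW cU.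
  by move=> z zb; rewrite -uv; [exact/HU/sd'|exact: sd].
by move=> z zb; exact/SU/sd'.
Qed.

Lemma is_derive_shift (R : realType) (f : R -> R) (x h df : R) :
  is_derive (x + h) (1 : R) f df -> is_derive x (1 : R) (fun y : R => f (y + h)) df.
Proof.
move=> H; have := @is_derive1_comp R f (fun y : R => y + h) x df 1 H.
move=> H2; have : is_derive x (1 : R) (fun y : R => y + h) 1.
  by apply: is_derive_eq; rewrite addr0.
by move=> /H2 /is_derive_eq; apply; rewrite mulr1.
Qed.

Lemma subsol_shift (R : realType) (a b r h s : R) (u : R * R -> R) (x t : R) :
  subsol a b r u (x + h, t + s) -> subsol a b r (fun z => u (z.1 + h, z.2 + s)) (x, t).
Proof.
move=> [d d0 Hu]; exists d => // e e0.
have [U [Ut [Ux [Uxx [cU HU SU]]]]] := Hu _ e0.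
pose S (z : R * R) := (z.1 + h, z.2 + s).
have Sb z : ball (x, t) d z -> ball (x + h, t + s) d (S z).
  move=> /ball_prodE[/= z1 z2]; apply/ball_prodE => /=.
  by rewrite !opprD !(addrACA _ _ (- _) (- _)) !subrr !addr0.
exists (U \o S), (Ut \o S), (Ux \o S), (Uxx \o S); split.
- move=> z /Sb zb; have [c1 c2 c3 c4] := cU _ zb; split.
  + apply: continuous_comp; last exact: c1.
    apply: (@cvg_pair _ _ _ _ (nbhs (z.1 + h)) (nbhs (z.2 + s))) => /=.
      by apply: cvgD; [exact: cvg_fst|exact: cvg_cst].
    by apply: cvgD; [exact: cvg_snd|exact: cvg_cst].
  + exact: (@is_derive_shift R (fun t => U (z.1 + h, t))).
  + exact: (@is_derive_shift R (fun x => U (x, z.2 + s))).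
  + exact: (@is_derive_shift R (fun x => Ux (x, z.2 + s))).
- by move=> z /Sb; exact: HU.
- by move=> z /Sb; exact: SU.
Qed.

(** [g] is only assumed differentiable at [x0]. If [h > 0], then [g > 0] just to the right of [x0],
    and the mean value theorem lifts [f] above its maximum. *)
Lemma second_derivative_at_max (R : realType) (f g : R -> R) (x0 d h : R) : 0 < d ->
  (forall x, `|x0 - x| < d -> is_derive x (1 : R) f (g x)) ->
  is_derive x0 (1 : R) g h ->
  (forall x, `|x0 - x| < d -> f x <= f x0) ->
  g x0 = 0 /\ h <= 0.
Proof.
move=> d0 df dg fmax.
have inI x : x \in `](x0 - d), (x0 + d)[ -> `|x0 - x| < d.
  by rewrite in_itv /= => /andP[? ?]; rewrite ltr_norml; lra.
have g0 : g x0 = 0.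
  have x0I : x0 \in `](x0 - d), (x0 + d)[ by rewrite in_itv /=; lra.
  have : is_derive x0 1 f 0.
    apply: (@derive1_at_max R f (x0 - d) (x0 + d) x0) => //; first lra.
      by move=> x /inI /df [].
    by move=> x /inI /fmax.
  by move=> [_ <-]; have [|_ ->//] := df x0; rewrite subrr normr0.
split => //; rewrite leNgt; apply/negP => h0.
have Hd : (k^-1 *: (g (k *: 1 + x0) - g x0)) @[k --> (0:R)^'] --> h.
  by have [d1 <-] := dg; exact: d1.
have [e /= e0 He] := cvgr_gt _ Hd _ h0.
pose k := Num.min (e / 2) (d / 2).
have k0 : 0 < k by rewrite lt_min; lra.
have ke : k < e by rewrite gt_min; apply/orP; left; lra.
have kd : k < d by rewrite gt_min; apply/orP; right; lra.
have dfI x : x0 <= x <= x0 + k -> is_derive x (1 : R) f (g x).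
  by move=> xI; apply: df; rewrite ltr_norml; lra.
have x0k : x0 < x0 + k by lra.
have D1 x : x \in `]x0, (x0 + k)[ -> is_derive x (1 : R) f (g x).
  by rewrite in_itv /= => xI; apply: dfI; lra.
have D2 : {within `[x0, x0 + k], continuous f}.
  apply: derivable_within_continuous => x; rewrite in_itv /= => xI.
  by have [] := dfI x xI.
have [c cI E] := MVT x0k D1 D2.
move: cI; rewrite in_itv /= => cI.
have gc : 0 < g c.
  have := He (c - x0); rewrite /ball_ /= sub0r normrN g0 subr0.
  rewrite [(_ *: 1)%R]mulr1 subrK => H; have cx0 : 0 < c - x0 by lra.
  have : 0 < (c - x0)^-1 * g c by apply: H; [rewrite gtr0_norm//; lra|rewrite gt_eqF].
  by rewrite pmulr_rgt0// invr_gt0.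
have : f (x0 + k) <= f x0 by apply: fmax; rewrite ltr_norml; lra.
have : 0 < g c * (x0 + k - x0) by apply: mulr_gt0 => //; lra.
lra.
Qed.

Lemma compact_box (R : realType) (z0 : R * R) (d : R) :
  compact (`[z0.1 - d, z0.1 + d] `*` `[z0.2 - d, z0.2 + d] : set (R * R)).
Proof. by apply: compact_setX; exact: segment_compact. Qed.

Lemma is_derive_sqrB (R : realType) (c x : R) :
  is_derive x (1 : R) (fun t : R => (t - c) ^+ 2) (2 * (x - c)).
Proof.
have d : is_derive x (1 : R) (fun t : R => t - c) 1.
  by apply: is_derive_eq; rewrite subr0.
have := @is_deriveX _ _ (fun t : R => t - c) 2 x 1 1 d.
by move/is_derive_eq; apply; rewrite /GRing.scale /= expr1; ring.
Qed.

Lemma classical_square (R : realType) (th : R) (z0 : R * R) :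
  classical setT (fun z => th * ((z.1 - z0.1) ^+ 2 + (z.2 - z0.2) ^+ 2))
    (fun z => th * (2 * (z.2 - z0.2))) (fun z => th * (2 * (z.1 - z0.1)))
    (fun z => th * 2).
Proof.
move=> z _; split.
- have c1 : {for z, continuous (fun z : R * R => z.1 - z0.1)}.
    by apply: cvgB; [exact: cvg_fst|exact: cvg_cst].
  have c2 : {for z, continuous (fun z : R * R => z.2 - z0.2)}.
    by apply: cvgB; [exact: cvg_snd|exact: cvg_cst].
  apply: cvgM; first exact: cvg_cst.
  by apply: cvgD; apply: cvgM.
- have d := is_deriveZ th (is_deriveD (is_derive_cst ((z.1 - z0.1) ^+ 2) z.2 1) (is_derive_sqrB z0.2 z.2)).
  by move/is_derive_eq: d; apply; rewrite /GRing.scale /=; ring.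
- have d := is_deriveZ th (is_deriveD (is_derive_sqrB z0.1 z.1) (is_derive_cst ((z.2 - z0.2) ^+ 2) z.1 1)).
  by move/is_derive_eq: d; apply; rewrite /GRing.scale /=; ring.
- have d : is_derive z.1 (1 : R) (fun x : R => x - z0.1) 1.
    by apply: is_derive_eq; rewrite subr0.
  have := is_deriveZ th (is_deriveZ 2 d).
  by move/is_derive_eq; apply; rewrite /GRing.scale /=; ring.
Qed.

(** A violated inequality at [z0] persists nearby with a margin [k]. At an interior maximum of the
    approximation minus the test function the derivatives of the two can be compared, and errors
    below [k] contradict the violation. *)
Lemma subsol_viscosity (R : realType) (a b r : R) (w : R * R -> R) (z0 : R * R) :
  0 <= a -> 0 <= r -> subsol a b r w z0 -> viscosity_subsol a b r w z0.
Proof.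
move=> a0 r0 [d1 d10 Hw] d2 F Ft Fx Fxx d20 CF cFt cFx cFxx wmax.
rewrite leNgt; apply/negP => Hgt.
(* The test function is lifted by a constant so as to agree with [w] at [z0]. *)
set G := fun z => Ft z - (a * Fxx z + b * Fx z) + r * (w z0 + (F z - F z0)).
have cG : {for z0, continuous G}.
  have [cF _ _ _] := CF z0 (ballxx _ d20).
  apply: cvgD; first (apply: cvgB => //; apply: cvgD; apply: cvgM => //; exact: cvg_cst).
  apply: cvgM; first exact: cvg_cst.
  by apply: cvgD; [exact: cvg_cst|apply: cvgB => //; exact: cvg_cst].
have G0 : 0 < G z0 by rewrite /G subrr addr0; lra.
have [k k0 kG] : exists2 k : R, 0 < k & k < G z0 by exists (G z0 / 2); lra.
have Gn : \forall z \near z0, k < G z by apply: cvgr_gt cG _ kG.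
move/nbhs_ballP: Gn => [d3 /= d30 Gk].
have [d d0 [dd1 dd2 dd3]] : exists2 d : R, 0 < d & [/\ d < d1, d < d2 & d < d3].
  have m0 : 0 < Num.min d1 (Num.min d2 d3) by rewrite !lt_min d10 d20.
  exists (Num.min d1 (Num.min d2 d3) / 2); first by rewrite divr_gt0.
  by apply/and3P; rewrite -!lt_min ltr_pdivrMr// ltr_pMr// ltr1n.
(* [L] bounds the operator without its zeroth-order term on |z - z0|^2 over the box of half-width
   [d]; with [th * L = k / 2] the penalty uses half of the margin. *)
have [L L0 LE] : exists2 L : R, 0 < L & L = 2 * d + a * 2 + `|b| * (2 * d).
  by eexists; last reflexivity; have := normr_ge0 b; nra.
have [th th0 thL] : exists2 th : R, 0 < th & th * L = k / 2.
  exists (k / (2 * L)); first by rewrite divr_gt0// mulr_gt0.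
  by field; rewrite gt_eqF.
(* On the boundary of the box the penalty is at least [th * d ^ 2], while replacing [w] by [U]
   shifts differences by at most [2 * e]: the first bound keeps the maximum inside. The second holds
   the remaining error [(1 + r) * e] within a quarter of [k]. *)
have [e e0 [e1 re]] : exists2 e : R, 0 < e & 4 * e <= th * d ^+ 2 /\ (1 + r) * e <= k / 4.
  have r1 : 0 < 1 + r by rewrite ltr_wpDr.
  exists (Num.min (th * d ^+ 2 / 4) (k / 4 / (1 + r))).
    by rewrite lt_min !divr_gt0 ?mulr_gt0 ?exprn_gt0.
  split; first by rewrite mulrC -ler_pdivlMr// ge_min lexx.
  by rewrite mulrC -ler_pdivlMr// ge_min lexx orbT.
(* Adding [th * |z - z0| ^ 2] to [F] makes the maximum strict, so that it survives, inside the
   box, the replacement of [w] by its approximation [U]. *)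
have [U [Ut [Ux [Uxx [CU HU SU]]]]] := Hw _ e0.
pose P (z : R * R) := F z + th * ((z.1 - z0.1) ^+ 2 + (z.2 - z0.2) ^+ 2).
pose K : set (R * R) := `[z0.1 - d, z0.1 + d] `*` `[z0.2 - d, z0.2 + d].
have inK x t : `|z0.1 - x| <= d -> `|z0.2 - t| <= d -> K (x, t).
  by rewrite !ler_distlC => h1 h2; split; rewrite /= in_itv.
have Kb z d' : d < d' -> K z -> ball z0 d' z.
  move=> dd' [/=]; rewrite !in_itv /= -!ler_distlC => h1 h2; apply/ball_prodE.
  by split; exact: le_lt_trans dd'.
have CUP : classical (ball z0 (Num.min d1 d2)) (fun z => U z - P z)
   (fun z => Ut z - (Ft z + th * (2 * (z.2 - z0.2))))
   (fun z => Ux z - (Fx z + th * (2 * (z.1 - z0.1))))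
   (fun z => Uxx z - (Fxx z + th * 2)).
  apply: classicalD.
    by apply: classicalW CU; apply: le_ball; rewrite ge_min lexx.
  apply: classicalN; apply: classicalD.
    by apply: classicalW CF; apply: le_ball; rewrite ge_min lexx orbT.
  by apply: classicalW (classical_square th z0).
have dm : d < Num.min d1 d2 by rewrite lt_min dd1.
have Kz0 : K z0 by rewrite (surjective_pairing z0); apply: inK; rewrite subrr normr0 ltW.
have [[x1 t1] Kz1 z1max] : exists2 c, c \in K & forall t, t \in K -> U t - P t <= U c - P c.
  apply: (@compact_EVT_max _ R (fun z => U z - P z) K).
  - by exists z0.
  - exact: compact_box.
  - apply: continuous_in_subspaceT => z; rewrite inE => /(Kb _ _ dm) zb.
    by have [] := CUP _ zb.
pose z1 : R * R := (x1, t1).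
rewrite inE -/z1 in Kz1.
rewrite -/z1 in z1max.
have Kmax z : K z -> U z - P z <= U z1 - P z1 by move=> Kz; apply: z1max; rewrite inE.
have P0 : P z0 = F z0 by rewrite /P !subrr !expr0n /= addr0 mulr0 addr0.
have U1 := HU _ (Kb _ _ dd1 Kz1).
have U0 := HU _ (Kb _ _ dd1 Kz0).
have M1 := Kmax _ Kz0.
have W1 := wmax _ (Kb _ _ dd2 Kz1).
rewrite P0 in M1.
rewrite !ler_norml in U0 U1.
have Qs : th * ((z1.1 - z0.1) ^+ 2 + (z1.2 - z0.2) ^+ 2) <= 2 * e.
  move: M1; rewrite /P; lra.
have S1 : (z1.1 - z0.1) ^+ 2 + (z1.2 - z0.2) ^+ 2 < d ^+ 2.
  by rewrite -(ltr_pM2l th0) (le_lt_trans Qs)//; lra.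
have I1 : `|z0.1 - z1.1| < d.
  rewrite -(@ltr_pXn2r _ 2)// ?nnegrE ?(ltW d0)// real_normK ?num_real//.
  have := sqr_ge0 (z1.2 - z0.2); rewrite -(sqrrN (z0.1 - _)) opprB; lra.
have I2 : `|z0.2 - z1.2| < d.
  rewrite -(@ltr_pXn2r _ 2)// ?nnegrE ?(ltW d0)// real_normK ?num_real//.
  have := sqr_ge0 (z1.1 - z0.1); rewrite -(sqrrN (z0.2 - _)) opprB; lra.
have [rho rho0 [rho1 rho2]] : exists2 rho : R, 0 < rho &
    rho <= d - `|z0.1 - z1.1| /\ rho <= d - `|z0.2 - z1.2|.
  exists (Num.min (d - `|z0.1 - z1.1|) (d - `|z0.2 - z1.2|)).
    by rewrite lt_min !subr_gt0 I1.
  by rewrite !ge_min !lexx orbT.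
have Kx x : `|z1.1 - x| < rho -> K (x, z1.2).
  move=> xr; apply: inK; last exact: ltW.
  by rewrite (le_trans (ler_distD z1.1 _ _))// -lerBrDl (le_trans (ltW xr)).
have Kt t : `|z1.2 - t| < rho -> K (z1.1, t).
  move=> tr; apply: inK; first exact: ltW.
  by rewrite (le_trans (ler_distD z1.2 _ _))// -lerBrDl (le_trans (ltW tr)).
have [Dx Dxx] : Ux z1 - (Fx z1 + th * (2 * (z1.1 - z0.1))) = 0 /\
    Uxx z1 - (Fxx z1 + th * 2) <= 0.
  apply: (@second_derivative_at_max R (fun x => U (x, z1.2) - P (x, z1.2))
    (fun x => Ux (x, z1.2) - (Fx (x, z1.2) + th * (2 * (x - z0.1)))) z1.1 rho
    (Uxx z1 - (Fxx z1 + th * 2)) rho0).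
  + by move=> x /Kx /(Kb _ _ dm) /CUP[].
  + by have [] := CUP _ (Kb _ _ dm Kz1).
  + by move=> x /Kx /Kmax.
have Dt : Ut z1 - (Ft z1 + th * (2 * (z1.2 - z0.2))) = 0.
  have [_ + _ _] := CUP _ (Kb _ _ dm Kz1).
  have inI x : x \in `](z1.2 - rho), (z1.2 + rho)[ -> `|z1.2 - x| < rho.
    by rewrite in_itv /= ltr_distlC.
  have : is_derive z1.2 (1 : R) (fun t => U (z1.1, t) - P (z1.1, t)) 0.
    apply: (@derive1_at_max R _ (z1.2 - rho) (z1.2 + rho)).
    * by rewrite lerD2l ge0_cp// ltW.
    * by move=> t /inI /Kt /(Kb _ _ dm) /CUP[_ []].
    * by rewrite in_itv /= ltrBlDr ltrDl rho0.
    * by move=> t /inI /Kt /Kmax.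
  by move=> [_ <-] [_ ->].
have SU1 := SU _ (Kb _ _ dd1 Kz1).
have := Gk _ (Kb _ _ dd3 Kz1); rewrite /G => G1.
have T1 : th * (2 * (z1.2 - z0.2)) >= - (th * (2 * d)).
  by rewrite -mulrN ler_pM2l//; move: I2; rewrite ltr_norml; lra.
have T2 : b * (th * (2 * (z1.1 - z0.1))) <= th * (`|b| * (2 * d)).
  rewrite mulrCA ler_pM2l// (le_trans (ler_norm _))// normrM.
  by rewrite ler_wpM2l// normrM ger0_norm// ler_pM2l// distrC ltW.
have T3 : a * Uxx z1 <= a * (Fxx z1 + th * 2) by rewrite ler_wpM2l//; lra.
have E1 : b * Ux z1 = b * Fx z1 + b * (th * (2 * (z1.1 - z0.1))) by rewrite -mulrDr; congr (b * _); lra.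
have E3 : r * U z1 >= r * (w z0 + (F z1 - F z0)) - r * e.
  rewrite -mulrBr ler_wpM2l//; move: M1; rewrite /P.
  have : 0 <= th * ((z1.1 - z0.1) ^+ 2 + (z1.2 - z0.2) ^+ 2).
    by apply: mulr_ge0; [exact: ltW|apply: addr_ge0; exact: sqr_ge0].
  lra.
move: thL; rewrite LE; nra.
Qed.

(** * Mollification of weak solutions *)

(** The strict inequality makes the set where [alpha] must vanish open, so that the derivative
    inherits the condition with the same [e]. *)
Definition cutoff (R : realType) (e : R) (alpha : R -> R) :=
  smooth alpha /\ forall x, e < `|x| -> alpha x = 0.

Lemma cutoff_derive1 (R : realType) (e : R) (alpha : R -> R) :
  cutoff e alpha -> cutoff e (alpha^`())%classic.
Proof.
move=> [sa ea]; split=> [|x ex]; first exact: smooth_derive1.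
rewrite derive1E (_ : 'D_1 alpha x = 'D_1 (cst 0) x); last first.
  apply: near_eq_derive.
  near=> y; apply: ea.
  by near: y; apply: (@cvgr_gt _ _ (nbhs x) _ Num.norm `|x|) => //; apply: cvg_norm; exact: cvg_id.
by rewrite derive_cst.
Unshelve. all: by end_near. Qed.

Lemma cutoff_bounded (R : realType) (e : R) (alpha : R -> R) :
  cutoff e alpha -> exists2 M : R, 0 <= M & forall x, `|alpha x| <= M.
Proof.
move=> [sa ea].
pose e' := `|e|.
have e'0 : 0 <= e' by exact: normr_ge0.
have c : {within `[- e', e'], continuous (fun x => `|alpha x|)}.
  apply: continuous_subspaceT => x.
  by apply: cvg_norm; exact: smooth_continuous.
have ee : - e' <= e' by lra.
have [m _ Hm] := EVT_max ee c.
exists `|alpha m| => // x.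
have [xe|ex] := leP `|x| e.
  apply: Hm; rewrite in_itv /= -ler_norml.
  by rewrite (le_trans xe)// ler_norm.
by rewrite (ea _ ex) normr0.
Qed.

(** * Tensor products as test functions *)

Lemma derive_sectionx (R : realType) (f : R * R -> R) (z : R * R) :
  (fun h : R => h^-1 *: ((f \o shift z) (h *: ((1, 0) : R * R)) - f z)) =
  (fun h : R => h^-1 *: (((fun s : R => f (s, z.2)) \o shift z.1) (h *: (1 : R)) - f (z.1, z.2))).
Proof.
apply/funext => h /=; rewrite -surjective_pairing; congr (_ *: (f _ - _)).
by case: z => z1 z2; congr pair; rewrite /= /GRing.scale /= ?mulr0 ?add0r.
Qed.

Lemma derive_sectiont (R : realType) (f : R * R -> R) (z : R * R) :
  (fun h : R => h^-1 *: ((f \o shift z) (h *: ((0, 1) : R * R)) - f z)) =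
  (fun h : R => h^-1 *: (((fun s : R => f (z.1, s)) \o shift z.2) (h *: (1 : R)) - f (z.1, z.2))).
Proof.
apply/funext => h /=; rewrite -surjective_pairing; congr (_ *: (f _ - _)).
by case: z => z1 z2; congr pair; rewrite /= /GRing.scale /= ?mulr0 ?add0r.
Qed.

Definition tensor (R : realType) (A B : R -> R) (z : R * R) : R := A z.1 * B z.2.

Lemma tensor_dx (R : realType) (A B : R -> R) (z : R * R) : derivable A z.1 1 ->
  derivable (tensor A B) z ((1, 0) : R * R) /\
  partial_x (tensor A B) z = tensor (A^`())%classic B z.
Proof.
move=> dA.
have d : is_derive z.1 (1 : R) (fun s : R => A s * B z.2) ((A^`())%classic z.1 * B z.2).
  have dA' : is_derive z.1 (1 : R) A ((A^`())%classic z.1) by rewrite derive1E; exact: DeriveDef.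
  have := is_deriveM dA' (is_derive_cst (B z.2) z.1 1).
  by move/is_derive_eq; apply; rewrite /GRing.scale /= mulr0 add0r mulrC.
split.
  by rewrite /derivable derive_sectionx; have [] := d.
by rewrite /partial_x /derive derive_sectionx; have [_] := d.
Qed.

Lemma tensor_dt (R : realType) (A B : R -> R) (z : R * R) : derivable B z.2 1 ->
  derivable (tensor A B) z ((0, 1) : R * R) /\
  partial_t (tensor A B) z = tensor A (B^`())%classic z.
Proof.
move=> dB.
have d : is_derive z.2 (1 : R) (fun s : R => A z.1 * B s) (A z.1 * (B^`())%classic z.2).
  have dB' : is_derive z.2 (1 : R) B ((B^`())%classic z.2) by rewrite derive1E; exact: DeriveDef.
  exact: (is_deriveZ (A z.1) dB').
split.
  by rewrite /derivable derive_sectiont; have [] := d.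
by rewrite /partial_t /derive derive_sectiont; have [_] := d.
Qed.

Lemma partial_x_tensor (R : realType) (A B : R -> R) : smooth A ->
  partial_x (tensor A B) = tensor (A^`())%classic B.
Proof. by move=> sA; apply/funext => z; apply: (tensor_dx _ _).2; exact: smooth_derivable. Qed.

Lemma partial_t_tensor (R : realType) (A B : R -> R) : smooth B ->
  partial_t (tensor A B) = tensor A (B^`())%classic.
Proof. by move=> sA; apply/funext => z; apply: (tensor_dt _ _).2; exact: smooth_derivable. Qed.

Lemma continuous_tensor (R : realType) (A B : R -> R) :
  continuous A -> continuous B -> continuous (tensor A B).
Proof.
move=> cA cB z; apply: cvgM.
  by apply: continuous_comp; [exact: cvg_fst|exact: cA].
by apply: continuous_comp; [exact: cvg_snd|exact: cB].
Qed.

Lemma Ck_tensor (R : realType) n (A B : R -> R) : smooth A -> smooth B ->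
  Ck n (tensor A B).
Proof.
elim: n A B => [|n IH] A B sA sB /=.
  by apply: continuous_tensor; exact: smooth_continuous.
split.
- by move=> z; have [] := @tensor_dx R A B z (@smooth_derivable R A sA z.1).
- by move=> z; have [] := @tensor_dt R A B z (@smooth_derivable R B sB z.2).
- by rewrite partial_x_tensor//; apply: IH => //; exact: smooth_derive1.
- by rewrite partial_t_tensor//; apply: IH => //; exact: smooth_derive1.
Qed.

Definition cbox (R : realType) (z : R * R) (e : R) : set (R * R) :=
  `[z.1 - e, z.1 + e] `*` `[z.2 - e, z.2 + e].

Lemma cboxP (R : realType) (z y : R * R) (e : R) :
  cbox z e y <-> `|y.1 - z.1| <= e /\ `|y.2 - z.2| <= e.
Proof.
rewrite /cbox /= !in_itv /= !ler_norml; split=> -[h1 h2]; split; lra.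
Qed.

Lemma cbox_subset (R : realType) (z0 z : R * R) (d e : R) : e <= d -> ball z0 d z ->
  cbox z e `<=` cbox z0 (3 * d).
Proof.
move=> ed /ball_prodE[h1 h2] y /cboxP[h3 h4]; apply/cboxP.
by move: h1 h2 h3 h4; rewrite !ltr_norml !ler_norml => *; split; lra.
Qed.

Lemma closed_cbox (R : realType) (z : R * R) (e : R) : closed (cbox z e).
Proof. by apply: compact_closed; [exact: norm_hausdorff|exact: compact_box]. Qed.

Lemma smooth_shift (R : realType) (A : R -> R) (c : R) : smooth A -> smooth (fun x => A (x - c)).
Proof.
move=> sA n; have := @smoothn_affine R n 1 (- c) A (sA n).
by under eq_fun do rewrite mul1r.
Qed.

Lemma derive1_shift (R : realType) (A : R -> R) (c : R) : smooth A ->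
  (fun x => A (x - c))^`()%classic = (fun x => (A^`())%classic (x - c)).
Proof.
move=> sA; apply/funext => x; rewrite derive1E.
by have [_ ->] := is_derive_shift (smooth_is_derive sA (x - c)).
Qed.

Lemma test_function_tensor (R : realType) (Om : set (R * R)) (A B : R -> R) (z : R * R) (e : R) :
  smooth A -> smooth B -> cbox z e `<=` Om ->
  (forall y, ~ cbox z e y -> tensor A B y = 0) -> test_function Om (tensor A B).
Proof.
move=> sA sB zO AB0.
have S : closure [set y | tensor A B y != 0] `<=` cbox z e.
  rewrite [X in _ `<=` X](iffLR (closure_id _) (@closed_cbox _ z e)).
  apply: closure_subset => y /= yn0; apply: contrapT => /AB0 E.
  by rewrite E eqxx in yn0.
split; first by move=> n; exact: Ck_tensor.
- by apply: subclosed_compact S; [exact: closed_closure|exact: compact_box].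
- exact: subset_trans S zO.
Qed.

Lemma measurable_cbox (R : realType) (z : R * R) (e : R) :
  measurable (cbox z e : set (measurableTypeR R * measurableTypeR R)).
Proof. by apply: measurableX; exact: measurable_itv. Qed.

Lemma lebesgue2_cbox (R : realType) (z : R * R) (e : R) : (lebesgue2 R (cbox z e) < +oo)%E.
Proof.
have fin (p q : R) : (lebesgue_measure (`[p, q]%classic : set (measurableTypeR R)) < +oo)%E.
  by rewrite lebesgue_measure_itv; case: ifP => _; rewrite ?ltry// -EFinB ltry.
have E := @product_measure1E _ _ _ _ R (@lebesgue_measure R) (@lebesgue_measure R)
  `[z.1 - e, z.1 + e]%classic `[z.2 - e, z.2 + e]%classic
  (measurable_itv _) (measurable_itv _).
rewrite (_ : lebesgue2 R (cbox z e) = (lebesgue_measure `[(z.1 - e)%R, (z.1 + e)%R]%classic *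
  lebesgue_measure `[(z.2 - e)%R, (z.2 + e)%R]%classic)%E); last exact: E.
by rewrite lte_mul_pinfty// ge0_fin_numE.
Qed.

Lemma measurable_tensor (R : realType) (A B : R -> R) (D : set (measurableTypeR R * measurableTypeR R)) :
  continuous A -> continuous B ->
  measurable_fun D (tensor A B : measurableTypeR R * measurableTypeR R -> R).
Proof.
move=> cA cB; apply: measurable_funTS; apply: measurable_funM.
  by apply: measurableT_comp; [exact: continuous_measurable_fun|exact: measurable_fst].
by apply: measurableT_comp; [exact: continuous_measurable_fun|exact: measurable_snd].
Qed.

Lemma Rintegral_support (R : realType) (K Om : set (R * R)) (f : R * R -> R) :
  K `<=` Om -> (forall y, ~ K y -> f y = 0) ->
  \int[lebesgue2 R]_(y in Om) f y = \int[lebesgue2 R]_(y in K) f y.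
Proof.
move=> KO f0; rewrite [LHS]Rintegral_mkcond [RHS]Rintegral_mkcond.
congr (Rintegral _ _ _); apply/funext => y; rewrite !patchE.
case: (asboolP (K y)) => Ky.
  by rewrite !mem_set//; exact: KO.
by rewrite f0//; rewrite !if_same.
Qed.

(** As a function of [z] this is a mollification of [v]; as a function of the integration
    variable, the kernel is an admissible test function, so that all derivatives of the
    mollification can be traded for weak derivatives of [v]. *)
Definition conv (R : realType) (K : set (R * R)) (v : R * R -> R) (A B : R -> R)
    (z : R * R) : R :=
  \int[lebesgue2 R]_(y in K) (v y * tensor (fun s => A (s - z.1)) (fun s => B (s - z.2)) y).

Lemma cutoff_continuous_shift (R : realType) (e : R) (A : R -> R) (c : R) :
  cutoff e A -> continuous (fun s => A (s - c)).
Proof. by move=> [sA _]; exact/smooth_continuous/smooth_shift. Qed.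

Lemma tensor_bounded (R : realType) (e : R) (A B : R -> R) : cutoff e A -> cutoff e B ->
  exists2 M : R, 0 <= M & forall x t, `|A x * B t| <= M.
Proof.
move=> /cutoff_bounded[M M0 HM] /cutoff_bounded[N N0 HN].
by exists (M * N); [exact: mulr_ge0|move=> x t; rewrite normrM ler_pM].
Qed.

Lemma integrable_tensor (R : realType) (e : R) (K : set (R * R)) (v : R * R -> R) (A B : R -> R) (z : R * R) :
  measurable (K : set (measurableTypeR R * measurableTypeR R)) ->
  (lebesgue2 R).-integrable K (EFin \o v) -> cutoff e A -> cutoff e B ->
  (lebesgue2 R).-integrable K
    (EFin \o (fun y => v y * tensor (fun s => A (s - z.1)) (fun s => B (s - z.2)) y)).
Proof.
move=> mK iv kA kB.
pose h : measurableTypeR R * measurableTypeR R -> R :=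
  tensor (fun s => A (s - z.1)) (fun s => B (s - z.2)).
rewrite (_ : EFin \o _ = ((EFin \o v) \* (EFin \o h))%E)//.
apply: integrableMl => //.
  by apply: measurable_tensor; [exact: (@cutoff_continuous_shift R e A z.1 kA)|exact: (@cutoff_continuous_shift R e B z.2 kB)].
have [M M0 HM] := tensor_bounded kA kB.
exists M; split; first exact: num_real.
by move=> N MN y _ /=; apply: le_trans (ltW MN); exact: HM.
Qed.

Lemma integrable_bound (R : realType) (K : set (R * R)) (v : R * R -> R) (M : R) :
  measurable (K : set (measurableTypeR R * measurableTypeR R)) ->
  (lebesgue2 R).-integrable K (EFin \o v) ->
  (lebesgue2 R).-integrable K (EFin \o (fun y => `|v y| * M)).
Proof.
move=> mK iv.
rewrite (_ : EFin \o _ = (fun y => M%:E * `|(EFin \o v) y|)%E).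
  by apply: integrableZl => //; exact: integrable_abse.
by apply/funext => y /=; rewrite EFinM muleC.
Qed.

Lemma conv_bounded (R : realType) (e : R) (K : set (R * R)) (v : R * R -> R) (A B : R -> R) :
  measurable (K : set (measurableTypeR R * measurableTypeR R)) ->
  (lebesgue2 R).-integrable K (EFin \o v) -> cutoff e A -> cutoff e B ->
  exists2 C : R, 0 <= C & forall z, `|conv K v A B z| <= C.
Proof.
move=> mK iv kA kB; have [M M0 HM] := tensor_bounded kA kB.
exists (\int[lebesgue2 R]_(y in K) (`|v y| * M)).
  by apply: Rintegral_ge0 => y _; exact: mulr_ge0.
move=> z; apply: le_trans (le_normr_Rintegral mK (integrable_tensor z mK iv kA kB)) _.
apply: le_Rintegral => //.
- have := integrable_abse (integrable_tensor z mK iv kA kB).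
  by rewrite (_ : (_ \o _)%E = EFin \o (fun y : R * R => `|v y * tensor (fun s => A (s - z.1)) (fun s => B (s - z.2)) y|)).
- exact: integrable_bound.
- by move=> y _; rewrite normrM ler_wpM2l//; exact: HM.
Qed.

Lemma is_derive_reflect (R : realType) (A : R -> R) (c x : R) : smooth A ->
  is_derive x (1 : R) (fun s : R => A (c - s)) (- (A^`())%classic (c - x)).
Proof.
move=> sA.
have d : is_derive x (1 : R) (fun s : R => c - s) (- 1).
  have := is_deriveB (is_derive_cst c x 1) (is_derive_id x (1 : R)).
  by move/is_derive_eq; apply; rewrite sub0r.
have := @is_derive1_comp R A (fun s : R => c - s) x _ _ (smooth_is_derive sA (c - x)) d.
by move/is_derive_eq; apply; rewrite mulrN1.
Qed.

Lemma is_derive_Rintegral (R : realType) (K : set (R * R)) (f df : R -> R * R -> R) (a : R)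
    (G : R * R -> R) :
  measurable (K : set (measurableTypeR R * measurableTypeR R)) ->
  (forall x, (lebesgue2 R).-integrable K (EFin \o f x)) ->
  (forall x y, K y -> is_derive x (1 : R) (f ^~ y) (df x y)) ->
  (forall y, 0 <= G y) -> (lebesgue2 R).-integrable K (EFin \o G) ->
  (forall x y, K y -> `|df x y| <= G y) ->
  is_derive a (1 : R) (fun x => \int[lebesgue2 R]_(y in K) f x y)
    (\int[lebesgue2 R]_(y in K) df a y).
Proof.
move=> mK intf derf G0 intG HG.
have I : `]a - 1, a + 1[%classic a by rewrite /= in_itv /=; lra.
have dE x y : K y -> partial1of2 f x y = df x y.
  by move=> Ky; rewrite /partial1of2 derive1E; have [_ ->] := derf x y Ky.
have HG' x y : `]a - 1, a + 1[%classic x -> K y -> `|partial1of2 f x y| <= G y.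
  by move=> _ Ky; rewrite dE//; exact: HG.
have H := @cvg_differentiation_under_integral R _ _ (lebesgue2 R) f K mK a (a - 1) (a + 1) I
  (fun x _ => intf x) (fun x y _ Ky => @ex_derive _ _ _ _ _ _ _ (derf x y Ky)) G G0 intG HG'.
rewrite (@eq_Rintegral _ _ _ (lebesgue2 R) K (df a) (partial1of2 f a)) in H; last first.
  by move=> y; rewrite inE => /dE ->.
have H' : (h^-1 *: (((fun x => \int[lebesgue2 R]_(y in K) f x y) \o shift a) (h *: (1 : R)) -
    \int[lebesgue2 R]_(y in K) f a y)) @[h --> (0:R)^'] --> \int[lebesgue2 R]_(y in K) df a y.
  have E : (fun h : R => h^-1 *: (((fun x => \int[lebesgue2 R]_(y in K) f x y) \o shift a) (h *: (1 : R)) -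
    \int[lebesgue2 R]_(y in K) f a y)) = (fun h : R => h^-1 *: (\int[lebesgue2 R]_(y in K) f (h + a) y - \int[lebesgue2 R]_(y in K) f a y)).
    by apply/funext => h /=; rewrite /GRing.scale /= mulr1.
  by rewrite E.
by apply: DeriveDef; [exact: cvgP H'|exact: cvg_lim H'].
Qed.

Lemma conv_dx (R : realType) (e : R) (K : set (R * R)) (v : R * R -> R) (A B : R -> R) (z : R * R) :
  measurable (K : set (measurableTypeR R * measurableTypeR R)) ->
  (lebesgue2 R).-integrable K (EFin \o v) -> cutoff e A -> cutoff e B ->
  is_derive z.1 (1 : R) (fun x => conv K v A B (x, z.2)) (- conv K v (A^`())%classic B z).
Proof.
move=> mK iv kA kB.
have kA' := cutoff_derive1 kA.
have [M M0 HM] := tensor_bounded kA' kB.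
have H := @is_derive_Rintegral R K
  (fun x y => v y * tensor (fun s => A (s - x)) (fun s => B (s - z.2)) y)
  (fun x y => - (v y * tensor (fun s => (A^`())%classic (s - x)) (fun s => B (s - z.2)) y))
  z.1 (fun y => `|v y| * M) mK.
rewrite /conv -(mulN1r (\int[_]_(_ in _) _)) -RintegralZl//; last exact: (integrable_tensor z mK iv kA' kB).
under [X in is_derive _ _ _ X]eq_Rintegral do rewrite mulN1r.
apply: H.
- by move=> x; exact: (integrable_tensor (x, z.2) mK iv kA kB).
- move=> x y Ky; have d := is_derive_reflect y.1 x kA.1.
  have := is_deriveZ (v y) (is_deriveM d (is_derive_cst (B (y.2 - z.2)) x 1)).
  by move/is_derive_eq; apply; rewrite /tensor /GRing.scale /=; ring.
- by move=> y; exact: mulr_ge0.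
- exact: integrable_bound.
- by move=> x y _; rewrite normrN normrM ler_wpM2l//; exact: HM.
Qed.

Lemma conv_dt (R : realType) (e : R) (K : set (R * R)) (v : R * R -> R) (A B : R -> R) (z : R * R) :
  measurable (K : set (measurableTypeR R * measurableTypeR R)) ->
  (lebesgue2 R).-integrable K (EFin \o v) -> cutoff e A -> cutoff e B ->
  is_derive z.2 (1 : R) (fun t => conv K v A B (z.1, t)) (- conv K v A (B^`())%classic z).
Proof.
move=> mK iv kA kB.
have kB' := cutoff_derive1 kB.
have [M M0 HM] := tensor_bounded kA kB'.
have H := @is_derive_Rintegral R K
  (fun t y => v y * tensor (fun s => A (s - z.1)) (fun s => B (s - t)) y)
  (fun t y => - (v y * tensor (fun s => A (s - z.1)) (fun s => (B^`())%classic (s - t)) y))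
  z.2 (fun y => `|v y| * M) mK.
rewrite /conv -(mulN1r (\int[_]_(_ in _) _)) -RintegralZl//; last exact: (integrable_tensor z mK iv kA kB').
under [X in is_derive _ _ _ X]eq_Rintegral do rewrite mulN1r.
apply: H.
- by move=> x; exact: (integrable_tensor (z.1, x) mK iv kA kB).
- move=> x y Ky; have d := is_derive_reflect y.2 x kB.1.
  have := is_deriveZ (v y) (is_deriveZ (A (y.1 - z.1)) d).
  by move/is_derive_eq; apply; rewrite /tensor /GRing.scale /=; ring.
- by move=> y; exact: mulr_ge0.
- exact: integrable_bound.
- by move=> x y _; rewrite normrN normrM ler_wpM2l//; exact: HM.
Qed.

Lemma is_derive_lipschitz (R : realType) (f g : R -> R) (C : R) :
  (forall x, is_derive x (1 : R) f (g x)) -> (forall x, `|g x| <= C) ->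
  forall x y, `|f x - f y| <= C * `|x - y|.
Proof.
move=> df gC x y; wlog xy : x y / x < y => [H|].
  by have [/H//|/H|->] := ltgtP x y; [rewrite distrC (distrC y)|rewrite !subrr normr0 mulr0].
have c : {within `[x, y], continuous f}.
  by apply: derivable_within_continuous => s _; have [] := df s.
have [s _ E] := @MVT R f g x y xy (fun s _ => df s) c.
by rewrite distrC E normrM (distrC x) ler_wpM2r.
Qed.

(** Both partial derivatives are, up to sign, again of the form [conv], hence bounded; a Lipschitz
    bound in each variable gives joint continuity. *)
Lemma conv_continuous (R : realType) (e : R) (K : set (R * R)) (v : R * R -> R) (A B : R -> R) :
  measurable (K : set (measurableTypeR R * measurableTypeR R)) ->
  (lebesgue2 R).-integrable K (EFin \o v) -> cutoff e A -> cutoff e B ->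
  continuous (conv K v A B).
Proof.
move=> mK iv kA kB z.
have [C C0 HC] := conv_bounded mK iv (cutoff_derive1 kA) kB.
have [D D0 HD] := conv_bounded mK iv kA (cutoff_derive1 kB).
have L y : `|conv K v A B z - conv K v A B y| <= C * `|z.1 - y.1| + D * `|z.2 - y.2|.
  rewrite -(subrKA (conv K v A B (y.1, z.2))) (le_trans (ler_normD _ _))//; apply: lerD.
    rewrite {1}(surjective_pairing z).
    apply: (@is_derive_lipschitz R (fun x => conv K v A B (x, z.2)) (fun x => - conv K v (A^`())%classic B (x, z.2))).
      by move=> x; exact: (conv_dx (x, z.2) mK iv kA kB).
    by move=> x; rewrite normrN.
  rewrite {2}(surjective_pairing y).
  apply: (@is_derive_lipschitz R (fun x => conv K v A B (y.1, x)) (fun x => - conv K v A (B^`())%classic (y.1, x))).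
    by move=> x; exact: (conv_dt (y.1, x) mK iv kA kB).
  by move=> x; rewrite normrN.
apply/cvgrPdist_le => eps e0.
have k0 : 0 < eps / (C + D + 1) by apply: divr_gt0 => //; lra.
have E : eps = (C + D + 1) * (eps / (C + D + 1)) by field; lra.
apply: filterS (nbhsx_ballx z _ k0) => y /ball_prodE[h1 h2]; apply: le_trans (L y) _.
rewrite [leRHS]E; move: h1 h2 k0; set k := eps / _ => h1 h2 k0.
have := ler_wpM2l C0 (ltW h1); have := ler_wpM2l D0 (ltW h2); lra.
Qed.

(** * Mass of the kernel, uniform continuity, integration of almost everywhere inequalities *)

Lemma integral_shift (R : realType) (A : R -> R) (c : R) : continuous A -> (forall x, 0 <= A x) ->
  (\int[@lebesgue_measure R]_x (A (x - c))%:E = \int[@lebesgue_measure R]_x (A x)%:E)%E.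
Proof.
move=> cA A0.
have d (x : R) : is_derive x (1 : R) (fun x : R => x - c) 1.
  by apply: is_derive_eq; rewrite subr0.
have dE : (fun x : R => x - c)^`()%classic = cst 1.
  by apply/funext => x; rewrite derive1E; have [_ ->] := d x.
rewrite [RHS](@increasing_ge0_integration_by_substitutionT R (fun x => x - c) A) //.
- by rewrite dE; apply: eq_integral => x _ /=; rewrite mulr1.
- by move=> x y xy; rewrite ltrD2r.
- by rewrite dE; move=> x; exact: cvg_cst.
- by rewrite dE; exact: is_cvg_cst.
- by rewrite dE; exact: is_cvg_cst.
- by apply: cvg_addrr_Ny.
- by apply: cvg_addrr.
Qed.

(** Positive because [A > A 0 / 2] near 0, finite because [A] is bounded with bounded support. The
    mass need not be 1: [weak_subsol] divides by it. *)
Lemma integral_cutoff (R : realType) (e : R) (A : R -> R) : cutoff e A -> (forall x, 0 <= A x) -> 0 < A 0 ->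
  exists2 I : R, 0 < I & (\int[@lebesgue_measure R]_x (A x)%:E = I%:E)%E.
Proof.
move=> kA A0 A00.
have [M M0 HM] := cutoff_bounded kA.
have cA := smooth_continuous kA.1.
have mA : measurable_fun [set: measurableTypeR R] (EFin \o A).
  by apply/measurable_EFinP; exact: continuous_measurable_fun.
have He := kA.2.
have pos : (0 < \int[@lebesgue_measure R]_x (A x)%:E)%E.
  have [d /= d0 Hd] : \forall x \near 0, A 0 / 2 < A x by apply: (cvgr_gt _ (cA 0)); lra.
  apply: (@lt_le_trans _ _ (\int[@lebesgue_measure R]_(x in `[0%R, (d / 2)%R]) (A 0 / 2)%:E)%E).
    rewrite integral_cst//= lebesgue_measure_itv /= lte_fin ifT; last by lra.
    by rewrite -EFinB -EFinM lte_fin; apply: mulr_gt0; lra.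
  apply: (@le_trans _ _ (\int[@lebesgue_measure R]_(x in `[0%R, (d / 2)%R]) (A x)%:E)%E).
    apply: ge0_le_integral => //.
    - by move=> x _; rewrite lee_fin; lra.
    - exact: measurable_funTS.
    - move=> x /=; rewrite in_itv /= => xI; rewrite lee_fin ltW//; apply: Hd.
      by rewrite /ball_ /= sub0r normrN ger0_norm; lra.
  by apply: ge0_subset_integral => // x _; rewrite lee_fin.
pose m := `|e|.
have fin : (\int[@lebesgue_measure R]_x (A x)%:E < +oo)%E.
  have E : (\int[@lebesgue_measure R]_x (A x)%:E = \int[@lebesgue_measure R]_(x in `[(- m)%R, m]) (A x)%:E)%E.
    rewrite [RHS]integral_mkcond; apply: eq_integral => x _; rewrite patchE.
    case: ifPn => //; rewrite notin_setE /= in_itv /= -ler_norml => /negP.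
    rewrite -ltNge => ex; rewrite He//; apply: le_lt_trans ex; exact: ler_norm.
  rewrite E; apply: (@le_lt_trans _ _ (\int[@lebesgue_measure R]_(x in `[(- m)%R, m]) M%:E)%E).
    apply: ge0_le_integral => //.
    - by move=> x _; rewrite lee_fin.
    - exact: measurable_funTS.
    - by move=> x _; rewrite lee_fin (le_trans (ler_norm _)).
  rewrite integral_cst//= lebesgue_measure_itv; case: ifP => _; last by rewrite mule0 ltry.
  by rewrite -EFinB -EFinM ltry.
exists (fine (\int[@lebesgue_measure R]_x (A x)%:E)%E).
  by apply: fine_gt0; rewrite pos fin.
by rewrite fineK// ge0_fin_numE// ltW.
Qed.

Lemma integral_tensor (R : realType) (e : R) (A : R -> R) (z : R * R) (I : R) :
  cutoff e A -> (forall x, 0 <= A x) -> (\int[@lebesgue_measure R]_x (A x)%:E = I%:E)%E ->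
  (\int[lebesgue2 R]_y (tensor (fun s => A (s - z.1)) (fun s => A (s - z.2)) y)%:E = (I * I)%:E)%E.
Proof.
move=> kA A0 HI.
have cA := smooth_continuous kA.1.
have I0 : 0 <= I by rewrite -lee_fin -HI; apply: integral_ge0 => x _; rewrite lee_fin.
rewrite /lebesgue2 fubini_tonelli1; first last.
- by move=> y; rewrite lee_fin; exact: mulr_ge0.
- by apply/measurable_EFinP; apply: measurable_tensor; [exact: (@cutoff_continuous_shift R e A z.1 kA)|exact: (@cutoff_continuous_shift R e A z.2 kA)].
rewrite /fubini_F /tensor /=.
under eq_integral => x _.
  under eq_integral do rewrite EFinM.
  rewrite ge0_integralZl//; first last.
  - by rewrite lee_fin.
  - by move=> y _; rewrite lee_fin.
  - by apply/measurable_EFinP; apply: continuous_measurable_fun; exact: (@cutoff_continuous_shift R e A z.2 kA).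
  rewrite (integral_shift z.2 cA A0) HI.
  over.
rewrite /= ge0_integralZr//.
- by rewrite (integral_shift z.1 cA A0) HI EFinM.
- by apply/measurable_EFinP; apply: continuous_measurable_fun; exact: (@cutoff_continuous_shift R e A z.1 kA).
- by move=> x _; rewrite lee_fin.
Qed.

(** Heine-Cantor, with continuity in the plane at the points of [K], so that [y] may lie outside
    [K]; the covering argument takes the radius as its parameter. *)
Lemma compact_unif_continuous (R : realType) (K : set (R * R)) (u : R * R -> R) (eps : R) :
  compact K -> (forall z, K z -> {for z, continuous u}) -> 0 < eps ->
  exists2 d : R, 0 < d & forall z y, K z -> ball z d y -> `|u z - u y| <= eps.
Proof.
move=> cK cu e0.
pose P (d : R) (z : R * R) := forall y, ball z d y -> `|u z - u y| <= eps.
have H : \forall d \near (0 : R)^'+, K `<=` P d.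
  apply: (iffLR (compact_near_coveringP K) cK) => z Kz.
  have e2 : 0 < eps / 2 by lra.
  have /cvgrPdist_lt/(_ _ e2)/nbhs_ballP[d /= d0 Hd] := cu z Kz.
  exists (ball z (d / 2), [set i : R | i < d / 2]) => /=.
    split; first by apply: nbhsx_ballx; lra.
    by apply: nbhs_right_lt; lra.
  move=> [y i] /= [zy id] x yx.
  have zy' : ball z d y by apply: le_ball zy; lra.
  have zx : ball z d x.
    by rewrite (splitr d); apply: ball_triangle zy _; apply: le_ball yx; exact: ltW.
  have := Hd _ zy'; have := Hd _ zx => /= h1 h2.
  rewrite -(subrKA (u z)) (splitr eps) (le_trans (ler_normD _ _))// lerD// ltW//.
  by rewrite distrC.
have [d [d0 Hd]] := filter_ex (filterI (nbhs_right_gt (0 : R)) H).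
by exists d => // z y Kz; exact: Hd.
Qed.

(** On [K], up to a null set, [- f] is its positive part, whose sign holds at every point. *)
Lemma ae_Rintegral_le0 (R : realType) (K : set (R * R)) (f : R * R -> R) :
  measurable (K : set (measurableTypeR R * measurableTypeR R)) ->
  (lebesgue2 R).-integrable K (EFin \o f) ->
  {ae lebesgue2 R, forall z, K z -> f z <= 0} ->
  \int[lebesgue2 R]_(y in K) f y <= 0.
Proof.
move=> mK intf aef.
have mf : measurable_fun (K : set (measurableTypeR R * measurableTypeR R)) (EFin \o f).
  by have /integrableP[] := intf.
pose g z := Num.max (- f z) 0.
have mg : measurable_fun (K : set (measurableTypeR R * measurableTypeR R)) (EFin \o g).
  apply/measurable_EFinP; apply: measurable_maxr => //.
  by apply: measurableT_comp => //; exact/measurable_EFinP.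
have mNf : measurable_fun (K : set (measurableTypeR R * measurableTypeR R)) (EFin \o (fun z => - f z)).
  by apply/measurable_EFinP; apply: measurableT_comp => //; exact/measurable_EFinP.
rewrite -oppr_ge0 -mulN1r -RintegralZl// /Rintegral (@ae_eq_integral _ _ _ (lebesgue2 R) K (EFin \o g)) //.
- by apply: fine_ge0; apply: integral_ge0 => y Ky; rewrite lee_fin le_max lexx orbT.
- by under eq_fun do rewrite mulN1r.
- apply: (@filterS _ _ (ae_filter_ringOfSetsType (lebesgue2 R)) _ _ _ aef) => z fz Kz.
  by congr EFin; rewrite /g max_l ?mulN1r// oppr_ge0; exact: fz.
Qed.

Definition mollifier (R : realType) (eta x : R) : R := bump (eta^-1 * x + 0).

Lemma cutoff_mollifier (R : realType) (eta : R) : 0 < eta -> cutoff eta (mollifier eta).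
Proof.
move=> eta0; split; first by move=> n; apply: smoothn_affine; exact: smooth_bump.
move=> x ex; apply: bump_eq0; rewrite addr0 normrM gtr0_norm ?invr_gt0//.
by rewrite -ler_pdivrMl ?invr_gt0// invrK mulr1 ltW.
Qed.

(** The factor [s], 1 or -1 in the applications, treats sub- and supersolutions together. The
    mollified function satisfies the differential inequality without error; [eps] is spent on the
    uniform distance alone. The radius [3 * d] leaves room for kernels centred anywhere in the ball
    of radius [d]. *)
Lemma weak_subsol (R : realType) (a b r s : R) (Om : set (R * R)) (u ux uxx ut : R * R -> R)
    (z0 : R * R) (d : R) :
  0 < d -> cbox z0 (3 * d) `<=` Om ->
  weak_derivative Om 1 0 u ux -> weak_derivative Om 2 0 u uxx -> weak_derivative Om 0 1 u ut ->
  (forall z, cbox z0 (3 * d) z -> {for z, continuous u}) ->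
  {ae lebesgue2 R, forall z, cbox z0 (3 * d) z ->
    s * (ut z - (a * uxx z + b * ux z - r * u z)) <= 0} ->
  subsol a b r (fun z => s * u z) z0.
Proof.
move=> d0; set K := cbox z0 (3 * d) => KO [Lu Lux Hx] [_ Luxx Hxx] [_ Lut Ht] cu aeu.
exists d => // eps eps0.
have mK : measurable (K : set (measurableTypeR R * measurableTypeR R)) by exact: measurable_cbox.
have cK : compact K by exact: compact_box.
have iu := Lu K cK KO; have iux := Lux K cK KO; have iuxx := Luxx K cK KO.
have iut := Lut K cK KO.
(* The modulus of continuity must survive multiplication by [s]; the [+ 1] avoids dividing by 0. *)
have s1 : 0 < `|s| + 1 by rewrite ltr_wpDl.
have eps'0 : 0 < eps / (`|s| + 1) by exact: divr_gt0.
have [del del0 Hdel] := compact_unif_continuous cK cu eps'0.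
have [eta eta0 [etad etadel]] : exists2 eta : R, 0 < eta & eta < d /\ eta < del.
  have m0 : 0 < Num.min del d by rewrite lt_min del0.
  exists (Num.min del d / 2); first by rewrite divr_gt0.
  by apply/andP; rewrite andbC -lt_min ltr_pdivrMr// ltr_pMr// ltr1n.
pose A := mollifier eta.
have kA : cutoff eta A by exact: cutoff_mollifier.
have kA' := cutoff_derive1 kA.
have kA'' := cutoff_derive1 kA'.
have A0 x : 0 <= A x by exact: bump_ge0.
have A00 : 0 < A 0 by rewrite /A /mollifier mulr0 addr0; exact: bump0_gt0.
have [I I0 HI] := integral_cutoff kA A0 A00.
(* The kernel is a product of two copies of [A], of mass [I] each, and [c] normalises it. *)
pose c := (I * I)^-1.
have c0 : 0 < c by rewrite invr_gt0 mulr_gt0.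
have zK z : ball z0 d z -> cbox z eta `<=` K by apply: cbox_subset; exact: ltW.
have T0 z (B C : R -> R) : cutoff eta B -> cutoff eta C -> forall y, ~ cbox z eta y ->
    tensor (fun t => B (t - z.1)) (fun t => C (t - z.2)) y = 0.
  move=> kB kC y; rewrite cboxP => /not_andP[] /negP; rewrite -ltNge => h; rewrite /tensor.
    by rewrite kB.2// mul0r.
  by rewrite kC.2// mulr0.
have support z v (B C : R -> R) : ball z0 d z -> cutoff eta B -> cutoff eta C ->
    \int[lebesgue2 R]_(y in Om) (v y * tensor (fun t => B (t - z.1)) (fun t => C (t - z.2)) y) =
    conv K v B C z.
  move=> zb kB kC; apply: Rintegral_support => // y Ky; rewrite T0 ?mulr0//.
  by move=> /(zK z zb).
have total z : ball z0 d z ->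
    \int[lebesgue2 R]_(y in K) tensor (fun t => A (t - z.1)) (fun t => A (t - z.2)) y = I * I.
  move=> zb; rewrite -(@Rintegral_support R K setT)//.
    by rewrite /Rintegral (integral_tensor z kA A0 HI).
  by move=> y Ky; apply: T0 => // /(zK z zb).
exists (fun z => c * s * conv K u A A z), (fun z => c * s * - conv K u A (A^`())%classic z),
  (fun z => c * s * - conv K u (A^`())%classic A z),
  (fun z => c * s * conv K u ((A^`())^`())%classic A z).
split.
- move=> z zb; split.
  + by apply: cvgM; [exact: cvg_cst|exact: (conv_continuous mK iu kA kA)].
  + by apply: is_deriveZ; exact: (conv_dt (z.1, z.2) mK iu kA kA).
  + by apply: is_deriveZ; exact: (conv_dx (z.1, z.2) mK iu kA kA).
  + have := conv_dx z mK iu kA' kA => H.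
    have := is_deriveZ (c * s) (is_deriveN H).
    by rewrite opprK.
- move=> z zb.
  have Kz : K z by apply: (zK z zb); apply/cboxP; rewrite !subrr normr0; split; exact: ltW.
  pose F y := tensor (fun t => A (t - z.1)) (fun t => A (t - z.2)) y.
  have F0 y : 0 <= F y by exact: mulr_ge0.
  have i1 : (lebesgue2 R).-integrable K (EFin \o cst 1).
    apply: measurable_bounded_integrable => //; first exact: lebesgue2_cbox.
    by exists 1; split; [exact: num_real|move=> N N1 y _ /=; rewrite normr1 ltW].
  have iF : (lebesgue2 R).-integrable K (EFin \o F).
    have := integrable_tensor z mK i1 kA kA.
    by under eq_fun do rewrite mul1r.
  have iuF := integrable_tensor z mK iu kA kA.
  have iuzF : (lebesgue2 R).-integrable K (EFin \o (fun y => u z * F y)).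
    by have := integrableZl mK (u z) iF.
  have iB : (lebesgue2 R).-integrable K (EFin \o (fun y => u y * F y - u z * F y)).
    exact: (integrableB mK iuF iuzF).
  have E : c * s * conv K u A A z - s * u z =
    c * s * \int[lebesgue2 R]_(y in K) (u y * F y - u z * F y).
    rewrite RintegralB// RintegralZl// total//.
    rewrite -/(conv K u A A z) mulrBr; congr (_ - _).
    by rewrite /c; field; rewrite gt_eqF.
  rewrite E normrM normrM (gtr0_norm c0).
  have B1 : `|\int[lebesgue2 R]_(y in K) (u y * F y - u z * F y)| <= eps / (`|s| + 1) * (I * I).
    apply: le_trans (le_normr_Rintegral mK iB) _.
    rewrite -(total z zb) -RintegralZl//.
    apply: le_Rintegral => //.
    - exact: (integrable_abse iB).
    - exact: (integrableZl mK _ iF).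
    move=> y Ky; rewrite -mulrBl normrM (ger0_norm (F0 y)).
    case: (pselect (cbox z eta y)) => [/cboxP[h1 h2]|/(T0 z A A kA kA) E1]; last by rewrite /F E1 !mulr0.
    apply: ler_wpM2r => //; rewrite distrC; apply: Hdel => //; apply/ball_prodE.
    by rewrite (distrC z.1) (distrC z.2); split; exact: le_lt_trans etadel.
  apply: (@le_trans _ _ (c * `|s| * (eps / (`|s| + 1) * (I * I)))).
    by apply: ler_wpM2l => //; apply: mulr_ge0 => //; exact: ltW.
  rewrite (_ : _ * _ = `|s| / (`|s| + 1) * eps); last first.
    by rewrite /c; field; rewrite !gt_eqF.
  by rewrite ler_piMl ?(ltW eps0)// ler_pdivrMr// mul1r lerDl.
- move=> z zb.
  have tf : test_function Om (tensor (fun t => A (t - z.1)) (fun t => A (t - z.2))).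
    apply: (@test_function_tensor _ _ _ _ z eta).
    + exact: smooth_shift kA.1.
    + exact: smooth_shift kA.1.
    + by apply: subset_trans KO; exact: zK.
    + exact: T0.
  have sAz w := smooth_shift w kA.1.
  (* The kernel depends on y - z: each derivative in z costs a sign ([conv_dx], [conv_dt]) and each
     integration by parts another, so the two cancel. *)
  have Ex : conv K u (A^`())%classic A z = - conv K ux A A z.
    have := Hx _ tf; rewrite /= partial_x_tensor// derive1_shift//; last exact: kA.1.
    by rewrite !support// addn0 expr1 mulN1r.
  have Exx : conv K u ((A^`())^`())%classic A z = conv K uxx A A z.
    have := Hxx _ tf; rewrite /= partial_x_tensor// derive1_shift//; last exact: kA.1.
    rewrite partial_x_tensor; last exact: smooth_shift kA'.1.
    rewrite derive1_shift; last exact: kA'.1.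
    by rewrite !support// addn0 sqrrN expr1n mul1r.
  have Et : conv K u A (A^`())%classic z = - conv K ut A A z.
    have := Ht _ tf; rewrite /= partial_t_tensor// derive1_shift//; last exact: kA.1.
    by rewrite !support// add0n expr1 mulN1r.
  rewrite Ex Exx Et.
  have it := integrable_tensor z mK iut kA kA.
  have ix := integrable_tensor z mK iux kA kA.
  have ixx := integrable_tensor z mK iuxx kA kA.
  have iu' := integrable_tensor z mK iu kA kA.
  pose F y := tensor (fun t => A (t - z.1)) (fun t => A (t - z.2)) y.
  have iaxx : (lebesgue2 R).-integrable K (EFin \o (fun y => a * (uxx y * F y))).
    exact: (integrableZl mK a ixx).
  have ibx : (lebesgue2 R).-integrable K (EFin \o (fun y => b * (ux y * F y))).
    exact: (integrableZl mK b ix).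
  have iru : (lebesgue2 R).-integrable K (EFin \o (fun y => r * (u y * F y))).
    exact: (integrableZl mK r iu').
  have iab : (lebesgue2 R).-integrable K (EFin \o (fun y => a * (uxx y * F y) + b * (ux y * F y))).
    exact: (integrableD mK iaxx ibx).
  have iabr : (lebesgue2 R).-integrable K (EFin \o (fun y => a * (uxx y * F y) + b * (ux y * F y) - r * (u y * F y))).
    exact: (integrableB mK iab iru).
  have iall : (lebesgue2 R).-integrable K (EFin \o (fun y => ut y * F y - (a * (uxx y * F y) + b * (ux y * F y) - r * (u y * F y)))).
    exact: (integrableB mK it iabr).
  have isall : (lebesgue2 R).-integrable K (EFin \o (fun y => s * (ut y * F y - (a * (uxx y * F y) + b * (ux y * F y) - r * (u y * F y))))).
    exact: (integrableZl mK s iall).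
  have := ae_Rintegral_le0 mK isall.
  rewrite RintegralZl// RintegralB// RintegralB// RintegralD// !RintegralZl//.
  rewrite -/(conv K ut A A z) -/(conv K ux A A z) -/(conv K uxx A A z) -/(conv K u A A z) => le0.
  apply: (@le_trans _ _ 0); last exact: ltW.
  rewrite (_ : _ - _ = c * (s * (conv K ut A A z - (a * conv K uxx A A z + b * conv K ux A A z - r * conv K u A A z)))); last by ring.
  rewrite pmulr_rle0//; apply: le0.
  apply: (@filterS _ _ (ae_filter_ringOfSetsType (lebesgue2 R)) _ _ _ aeu) => y Hy Ky.
  rewrite (_ : _ * _ = s * (ut y - (a * uxx y + b * ux y - r * u y)) * F y); last by ring.
  by apply: mulr_le0_ge0; [exact: Hy|exact: mulr_ge0].
Qed.

(** * The comparison principle *)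

Lemma continuous_fst_at (R : realType) (f : R -> R) (z : R * R) :
  {for z.1, continuous f} -> {for z, continuous (fun y : R * R => f y.1)}.
Proof. by move=> cf; apply: continuous_comp cf; exact: cvg_fst. Qed.

Lemma continuous_snd_at (R : realType) (f : R -> R) (z : R * R) :
  {for z.2, continuous f} -> {for z, continuous (fun y : R * R => f y.2)}.
Proof. by move=> cf; apply: continuous_comp cf; exact: cvg_snd. Qed.

Lemma is_derive_continuous (R : realType) (f : R -> R) (x df : R) :
  is_derive x (1 : R) f df -> {for x, continuous f}.
Proof. by move=> [d _]; apply/differentiable_continuous/derivable1_diffP. Qed.

Lemma classical_prod (R : realType) (N : set (R * R)) (f f' f'' g g' : R -> R) :
  (forall z, N z -> is_derive z.1 (1 : R) f (f' z.1)) ->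
  (forall z, N z -> is_derive z.1 (1 : R) f' (f'' z.1)) ->
  (forall z, N z -> is_derive z.2 (1 : R) g (g' z.2)) ->
  classical N (fun z => f z.1 * g z.2) (fun z => f z.1 * g' z.2)
    (fun z => f' z.1 * g z.2) (fun z => f'' z.1 * g z.2).
Proof.
move=> df df' dg z Nz; split.
- by apply: cvgM; [apply: continuous_fst_at; exact: is_derive_continuous (df z Nz)|
    apply: continuous_snd_at; exact: is_derive_continuous (dg z Nz)].
- exact: (is_deriveZ (f z.1) (dg z Nz)).
- have := is_deriveM (df z Nz) (is_derive_cst (g z.2) z.1 1).
  by move/is_derive_eq; apply; rewrite /GRing.scale /= mulr0 add0r mulrC.
- have := is_deriveM (df' z Nz) (is_derive_cst (g z.2) z.1 1).
  by move/is_derive_eq; apply; rewrite /GRing.scale /= mulr0 add0r mulrC.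
Qed.

(** [W] only has to touch from above, at [z0], the function subtracted from [u]. *)
Lemma viscosity_subsolB (R : realType) (a b r d : R) (u w W Wt Wx Wxx : R * R -> R) (z0 : R * R) :
  0 < d -> viscosity_subsol a b r u z0 ->
  classical (ball z0 d) W Wt Wx Wxx ->
  {for z0, continuous Wt} -> {for z0, continuous Wx} -> {for z0, continuous Wxx} ->
  0 <= Wt z0 - (a * Wxx z0 + b * Wx z0 - r * W z0) ->
  (forall z, ball z0 d z -> u z - W z <= w z) -> w z0 = u z0 - W z0 ->
  viscosity_subsol a b r w z0.
Proof.
move=> d0 Hu CW cWt cWx cWxx SW uw uw0 d' F Ft Fx Fxx d'0 CF cFt cFx cFxx wmax.
have m0 : 0 < Num.min d d' by rewrite lt_min d0.
have sd : ball z0 (Num.min d d') `<=` ball z0 d by apply: le_ball; rewrite ge_min lexx.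
have sd' : ball z0 (Num.min d d') `<=` ball z0 d'.
  by apply: le_ball; rewrite ge_min lexx orbT.
have := Hu _ _ _ _ _ m0 (classicalD (classicalW sd CW) (classicalW sd' CF)).
move=> /(_ (cvgD cWt cFt) (cvgD cWx cFx) (cvgD cWxx cFxx)) H.
have {}H := H _; rewrite uw0.
suff /H : forall z, ball z0 (Num.min d d') z -> u z - (W z + F z) <= u z0 - (W z0 + F z0) by lra.
move=> z zb; have := uw _ (sd _ zb); have := wmax _ (sd' _ zb); rewrite uw0; lra.
Qed.

Lemma is_derive_expRM (R : realType) (k x : R) :
  is_derive x (1 : R) (fun s : R => expR (k * s)) (k * expR (k * x)).
Proof.
have d : is_derive x (1 : R) (fun s : R => k * s) k.
  have := is_deriveZ k (is_derive_id x (1 : R)).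
  by move/is_derive_eq; apply; rewrite /GRing.scale /= mulr1.
have := @is_derive1_comp R expR (fun s : R => k * s) x _ _ (is_derive_expR (k * x)) d.
by move/is_derive_eq; apply; rewrite mulrC.
Qed.

Lemma is_derive_invB (R : realType) (T x : R) : x != T ->
  is_derive x (1 : R) (fun s : R => (T - s)^-1) ((T - x) ^- 2).
Proof.
move=> xT.
have d : is_derive x (1 : R) (fun s : R => T - s) (- 1).
  have := is_deriveB (is_derive_cst T x 1) (is_derive_id x (1 : R)).
  by move/is_derive_eq; apply; rewrite sub0r.
have n0 : T - x != 0 by rewrite subr_eq0 eq_sym.
have := @is_deriveV R (fun s : R => T - s) x _ 1 n0 d.
by move/is_derive_eq; apply; rewrite /GRing.scale /= mulrN1 opprK.
Qed.

(** [f] is 2 cosh(2 x), a smooth substitute for e^(2 |x|); f'' = 4 f and |f'| <= 2 f bound the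
    spatial operator by a multiple of [f]. *)
Lemma growth_barrier (R : realType) : exists f f' : R -> R,
  [/\ forall x, is_derive x (1 : R) f (f' x), forall x, is_derive x (1 : R) f' (4 * f x),
      forall x, expR (2 * `|x|) <= f x & forall x, `|f' x| <= 2 * f x].
Proof.
exists (fun x => expR (2 * x) + expR (- 2 * x)), (fun x => 2 * expR (2 * x) + - 2 * expR (- 2 * x)).
split=> x.
- by apply: is_deriveD; exact: is_derive_expRM.
- have : is_derive x (1 : R) (fun x : R => 2 * expR (2 * x) + - 2 * expR (- 2 * x))
      (2 * (2 * expR (2 * x)) + - 2 * (- 2 * expR (- 2 * x))).
    by apply: is_deriveD; apply: is_deriveZ; exact: is_derive_expRM.
  by move/is_derive_eq; apply; ring.
- have [x0|x0] := lerP (0 : R) x.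
    by rewrite ?(ger0_norm x0) -[leLHS]addr0 lerD2l expR_ge0.
  by rewrite ?(ltr0_norm x0) mulrN -mulNr -[leLHS]add0r lerD2r expR_ge0.
- by have := expR_gt0 (2 * x); have := expR_gt0 (- 2 * x); rewrite ler_norml; lra.
Qed.

(** If [w] were positive somewhere, [w - de * h] would attain a positive maximum, since [h] wins for
    large |x| and near [T]. The initial and lateral signs push it into the interior, where the
    strict supersolution [de * h] is an admissible test function. *)
Lemma comparison_lt (R : realType) (a b r T C : R) (I J : set R) (w : R * R -> R) :
  0 <= a -> 0 <= r -> closed J -> open I ->
  {within J `*` `[0, T], continuous w} ->
  (forall x t, J x -> 0 <= t <= T -> w (x, t) <= C * expR `|x|) ->
  (forall x, J x -> w (x, 0) <= 0) ->
  (forall x t, J x -> ~ I x -> 0 <= t <= T -> w (x, t) <= 0) ->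
  I `<=` J ->
  (forall x t, I x -> 0 < t < T -> 0 < w (x, t) -> viscosity_subsol a b r w (x, t)) ->
  forall x t, J x -> 0 <= t < T -> w (x, t) <= 0.
Proof.
move=> a0 r0 cJ oI cw wC w0 wJ IJ wI x1 t1 Jx1 t1T.
rewrite leNgt; apply/negP => M0.
(* The term 4 a comes from f'' = 4 f, 2 |b| from |f'| <= 2 f, and 1 makes the inequality strict. *)
pose la := 4 * a + 2 * `|b| + 1.
have [f [f' [df df' f_ge f'_le]]] := @growth_barrier R.
(* [h] is a strict supersolution that dominates [e^|x|] at infinity and blows up at time [T]. *)
pose h (z : R * R) := f z.1 * expR (la * z.2) + 1 * (T - z.2)^-1.
have f0 x : 0 < f x by exact: lt_le_trans (expR_gt0 _) (f_ge x).
have T0 : 0 < T by lra.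
have hpos x t : t < T -> 0 < h (x, t).
  move=> tT; rewrite /h mul1r; apply: addr_gt0; first by apply: mulr_gt0 => //; exact: expR_gt0.
  by rewrite invr_gt0 subr_gt0.
have h1 : 0 < h (x1, t1) by apply: hpos; lra.
have [de de0 v1'] : exists2 de : R, 0 < de & 0 < w (x1, t1) - de * h (x1, t1).
  exists (w (x1, t1) / (2 * h (x1, t1))); first by rewrite divr_gt0// mulr_gt0.
  rewrite (_ : _ * h (x1, t1) = w (x1, t1) / 2); first lra.
  by field; rewrite gt_eqF.
pose v z := w z - de * h z.
have v1 : 0 < v (x1, t1) by [].
(* Beyond [X], e^|x| >= 1 + |x| >= |C| / de, so de e^(2 |x|) exceeds the growth bound of [w]; the
   other condition keeps [x1] inside. *)
have [X X1 XC] : exists2 X : R, `|x1| <= X & `|C| / de <= X.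
  exists (`|C| / de + `|x1|); first by rewrite lerDr divr_ge0// ltW.
  by rewrite lerDl.
have X0 : 0 <= X by apply: le_trans X1.
have la0 : 0 <= la by rewrite /la; have := normr_ge0 b; lra.
have far x t : J x -> 0 <= t < T -> X <= `|x| -> v (x, t) <= 0.
  move=> Jx tT Xx; rewrite /v subr_le0.
  apply: (@le_trans _ _ (`|C| * expR `|x|)).
    apply: le_trans (wC _ _ Jx _) _; first lra.
    by rewrite ler_wpM2r ?expR_ge0// ler_norm.
  have hx : expR (2 * `|x|) <= h (x, t).
    rewrite /h /=; apply: (@le_trans _ _ (f x * 1 + 0)).
      by rewrite mulr1 addr0; exact: f_ge.
    apply: lerD; last by rewrite mul1r invr_ge0; lra.
    rewrite ler_pM2l// -expR0 ler_expR; apply: mulr_ge0 => //; lra.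
  apply: (@le_trans _ _ (de * expR (2 * `|x|))); last by rewrite ler_pM2l.
  have -> : 2 * `|x| = `|x| + `|x| by lra.
  rewrite expRD mulrA ler_wpM2r ?expR_ge0// -ler_pdivrMl// mulrC.
  apply: le_trans (expR_ge1Dx _).
  by rewrite (le_trans XC)// (le_trans Xx)// lerDr.
have [D D0 DC] : exists2 D : R, 0 < D & `|C| * expR X <= D.
  exists (`|C| * expR X + 1); last by rewrite lerDl.
  by rewrite ltr_wpDl// mulr_ge0// expR_ge0.
(* [D] bounds [w] for |x| <= X. Within [ka] of the final time de / (T - t) exceeds [D], and
   [ka <= T - t1] keeps [t1] from lying beyond the start of that zone. *)
have [ka ka0 [ka1 kaD]] : exists2 ka : R, 0 < ka & ka <= T - t1 /\ ka <= de / D.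
  exists (Num.min (de / D) (T - t1)); last by rewrite !ge_min !lexx orbT.
  by rewrite lt_min divr_gt0//= subr_gt0; have /andP[] := t1T.
have late x t : J x -> T - ka <= t < T -> `|x| <= X -> v (x, t) <= 0.
  move=> Jx tT Xx; rewrite /v subr_le0.
  apply: (@le_trans _ _ D).
    apply: le_trans (wC _ _ Jx _) _; first lra.
    apply: le_trans DC.
    apply: (@le_trans _ _ (`|C| * expR `|x|)).
      by rewrite ler_wpM2r ?expR_ge0// ler_norm.
    by rewrite ler_wpM2l// ler_expR.
  have hx : (T - t)^-1 <= h (x, t).
    rewrite /h /= mul1r lerDr; apply: mulr_ge0; [exact: ltW|exact: expR_ge0].
  apply: (@le_trans _ _ (de * (T - t)^-1)); last by rewrite ler_pM2l.
  have Tt : 0 < T - t by lra.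
  rewrite ler_pdivlMr// mulrC -ler_pdivlMr//; lra.
pose K := (J `&` `[- X, X]) `*` `[0, T - ka].
have cK : compact K.
  apply: compact_setX; last exact: segment_compact.
  apply: (@subclosed_compact _ _ `[- X, X]); last by move=> x [].
    by apply: closedI => //; exact: itv_closed.
  exact: segment_compact.
have K1 : K (x1, t1).
  by split => /=; [split => //=; rewrite in_itv /= -ler_norml|rewrite in_itv /=; lra].
have Ch (N : set (R * R)) : (forall z, N z -> z.2 < T) -> classical N h
    (fun z => f z.1 * (la * expR (la * z.2)) + 1 * (T - z.2) ^- 2)
    (fun z => f' z.1 * expR (la * z.2) + 0 * (T - z.2)^-1)
    (fun z => 4 * f z.1 * expR (la * z.2) + 0 * (T - z.2)^-1).
  move=> NT; apply: classicalD.
    by apply: (@classical_prod R N f f' (fun x => 4 * f x) (fun s => expR (la * s)) (fun s => la * expR (la * s))) => // z _; exact: is_derive_expRM.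
  apply: (@classical_prod R N (cst 1) (cst 0) (cst 0) (fun s => (T - s)^-1) (fun s => (T - s) ^- 2)).
  by move=> z /NT zT; apply: is_derive_invB; rewrite lt_eqF.
have ch z : z.2 < T -> {for z, continuous h}.
  by move=> zT; have [|//] := Ch [set y | y.2 < T] _ z zT.
have [[x2 t2] Kz2 z2max] : exists2 c, c \in K & forall t, t \in K -> v t <= v c.
  apply: compact_EVT_max => //; first by exists (x1, t1).
  have c1 : {within K, continuous w}.
    apply: continuous_subspaceW cw => z [[/= Jz _]].
    by rewrite /= !in_itv /= => zt; split => //=; lra.
  have c2 : {within K, continuous h}.
    apply: continuous_in_subspaceT => z; rewrite inE => -[_ /=]; rewrite in_itv /= => zt.
    by apply: ch; lra.
  by move=> z; apply: cvgB; [exact: c1|apply: cvgM; [exact: cvg_cst|exact: c2]].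
rewrite inE in Kz2; have [[/= Jx2 _]] := Kz2; rewrite in_itv /= => t2I.
have t2T : t2 < T by lra.
have vmax x t : J x -> 0 <= t < T -> v (x, t) <= v (x2, t2).
  move=> Jx tT.
  have v2 : 0 < v (x2, t2) by apply: lt_le_trans v1 _; apply: z2max; rewrite inE.
  have [xX|/ltW xX] := lerP `|x| X; last by apply: le_trans (far _ _ Jx tT xX) _; exact: ltW.
  have [tk|tk] := lerP t (T - ka).
    by apply: z2max; rewrite inE; split => /=; [split => //=; rewrite in_itv /= -ler_norml|rewrite in_itv /=; lra].
  by apply: le_trans (late _ _ Jx _ xX) (ltW v2); lra.
have v2 : 0 < v (x2, t2) by apply: lt_le_trans v1 _; apply: vmax.
have w2 : 0 < w (x2, t2).
  have := hpos x2 t2 t2T; move: v2; rewrite /v => v2 h2.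
  have := mulr_gt0 de0 h2; lra.
have Ix2 : I x2.
  by apply: contrapT => nI; have := wJ _ _ Jx2 nI (_ : 0 <= t2 <= T); lra.
have t20 : 0 < t2.
  rewrite lt_neqAle; apply/andP; split; last by lra.
  by apply/eqP => E; have := w0 _ Jx2; rewrite E; lra.
have /nbhs_ballP[rho /= rho0 Hrho] : nbhs x2 I by exact: open_nbhs_nbhs.
have [d d0 [d1 d2 d3]] : exists2 d : R, 0 < d & [/\ d <= rho, d <= t2 & d <= T - t2].
  exists (Num.min rho (Num.min t2 (T - t2))); first by rewrite !lt_min rho0 t20 subr_gt0.
  by split; rewrite !ge_min lexx ?orbT.
have bd z : ball (x2, t2) d z -> I z.1 /\ 0 < z.2 < T.
  move=> /ball_prodE[/= z1 z2]; split; first by apply: Hrho; exact: lt_le_trans d1.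
  by move: z2; rewrite ltr_norml; lra.
have CF : classical (ball (x2, t2) d) (fun z => de * h z)
   (fun z => de * (f z.1 * (la * expR (la * z.2)) + 1 * (T - z.2) ^- 2))
   (fun z => de * (f' z.1 * expR (la * z.2) + 0 * (T - z.2)^-1))
   (fun z => de * (4 * f z.1 * expR (la * z.2) + 0 * (T - z.2)^-1)).
  move=> z zb; have [|c1 c2 c3 c4] := Ch _ _ z zb; first by move=> y /bd[_]; lra.
  split; [by apply: cvgM; [exact: cvg_cst|exact: c1]|exact: is_deriveZ..].
have cE : {for (x2, t2), continuous (fun z : R * R => expR (la * z.2))}.
  by apply: (@continuous_snd_at R (fun s => expR (la * s))); exact: is_derive_continuous (is_derive_expRM la t2).
have cV : {for (x2, t2), continuous (fun z : R * R => (T - z.2)^-1)}.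
  apply: (@continuous_snd_at R (fun s => (T - s)^-1)).
  by apply: is_derive_continuous (is_derive_invB _); rewrite lt_eqF.
have cV2 : {for (x2, t2), continuous (fun z : R * R => (T - z.2) ^- 2)}.
  rewrite (_ : (fun z : R * R => (T - z.2) ^- 2) = (fun z => (T - z.2)^-1 * (T - z.2)^-1)).
    exact: cvgM.
  by apply/funext => z; rewrite -exprVn expr2.
have cf : {for (x2, t2), continuous (fun z : R * R => f z.1)}.
  by apply: continuous_fst_at; exact: is_derive_continuous (df x2).
have cf' : {for (x2, t2), continuous (fun z : R * R => f' z.1)}.
  by apply: continuous_fst_at; exact: is_derive_continuous (df' x2).
have := wI _ _ Ix2 (_ : 0 < t2 < T) w2 d _ _ _ _ d0 CF.
move=> /(_ (introT andP (conj t20 t2T))) H.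
have {H} : de * (f x2 * (la * expR (la * t2)) + 1 * (T - t2) ^- 2) -
  (a * (de * (4 * f x2 * expR (la * t2) + 0 * (T - t2)^-1)) +
   b * (de * (f' x2 * expR (la * t2) + 0 * (T - t2)^-1)) - r * w (x2, t2)) <= 0.
  apply: H.
  - apply: cvgM; first exact: cvg_cst.
    apply: cvgD; first by apply: cvgM => //; apply: cvgM => //; exact: cvg_cst.
    apply: cvgM; first exact: cvg_cst.
    exact: cV2.
  - apply: cvgM; first exact: cvg_cst.
    by apply: cvgD; apply: cvgM => //; exact: cvg_cst.
  - apply: cvgM; first exact: cvg_cst.
    apply: cvgD; apply: cvgM => //; last exact: cvg_cst.
    by apply: cvgM => //; exact: cvg_cst.
  - move=> z /bd[Iz zT]; have := vmax z.1 z.2 (IJ _ Iz); rewrite -surjective_pairing /v; apply; lra.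
apply/negP; rewrite -ltNge !mul0r !addr0 mul1r.
(* The zeroth-order term involves [w], positive at this point, and not the barrier: it only
   helps. *)
have rw : 0 <= r * w (x2, t2) by apply: mulr_ge0 => //; exact: ltW.
have Tt : 0 < (T - t2) ^- 2 by rewrite invr_gt0 exprn_gt0// subr_gt0.
have f2 : b * f' x2 <= 2 * `|b| * f x2.
  by rewrite (le_trans (ler_norm _))// normrM -mulrA mulrCA ler_wpM2l.
have E0 : 0 < expR (la * t2) by exact: expR_gt0.
move: rw Tt f2 E0; set E := expR _; set V := (T - t2) ^- 2 => rw Tt f2 E0.
have P1 : 0 < de * (f x2 * E) by apply: mulr_gt0 => //; apply: mulr_gt0.
have P2 : 0 <= de * E * (2 * `|b| * f x2 - b * f' x2).
  apply: mulr_ge0; last by lra.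
  by apply: mulr_ge0; exact: ltW.
have P3 : 0 < de * V by exact: mulr_gt0.
rewrite (_ : _ - _ = de * (f x2 * E) + de * E * (2 * `|b| * f x2 - b * f' x2) + de * V + r * w (x2, t2)).
  lra.
rewrite /la; ring.
Qed.

(** The barrier is infinite at [T], so the final time is reached by continuity: a positive value
    there would persist slightly earlier. *)
Lemma comparison (R : realType) (a b r T C : R) (I J : set R) (w : R * R -> R) :
  0 <= a -> 0 <= r -> closed J -> open I -> I `<=` J ->
  {within J `*` `[0, T], continuous w} ->
  (forall x t, J x -> 0 <= t <= T -> w (x, t) <= C * expR `|x|) ->
  (forall x, J x -> w (x, 0) <= 0) ->
  (forall x t, J x -> ~ I x -> 0 <= t <= T -> w (x, t) <= 0) ->
  (forall x t, I x -> 0 < t < T -> 0 < w (x, t) -> viscosity_subsol a b r w (x, t)) ->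
  forall x t, J x -> 0 <= t <= T -> w (x, t) <= 0.
Proof.
move=> a0 r0 cJ oI IJ cw wC w0 wJ wI x t Jx /andP[t0].
rewrite le_eqVlt => /orP[/eqP E|tT]; last first.
  by apply: (comparison_lt a0 r0 cJ oI cw wC w0 wJ IJ wI) => //; rewrite t0.
have [E0|t0'] := eqVneq t 0; first by rewrite E0; exact: w0.
rewrite leNgt; apply/negP => wt.
have Kxt : (J `*` `[0, T]) (x, t) by split => //=; rewrite in_itv /=; lra.
have tp : 0 < t by rewrite lt_neqAle eq_sym t0'.
have /subspace_continuousP/(_ _ Kxt) cwt := cw.
have : \forall z \near within (J `*` `[0, T]) (nbhs (x, t)), 0 < w z by apply: cvgr_gt cwt _ wt.
rewrite near_withinE => /nbhs_ballP[d /= d0 Hd].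
pose s := t - Num.min (d / 2) t.
have m1 : Num.min (d / 2) t <= t by rewrite ge_min lexx orbT.
have m2 : Num.min (d / 2) t <= d / 2 by rewrite ge_min lexx.
have m0 : 0 < Num.min (d / 2) t by rewrite lt_min tp andbT; lra.
have : 0 < w (x, s).
  apply: Hd.
    apply/ball_prodE; rewrite /s /= subrr normr0 opprB addrC subrK gtr0_norm//; split => //; lra.
  by split => //=; rewrite in_itv /= /s; lra.
apply/negP; rewrite -leNgt.
by apply: (comparison_lt a0 r0 cJ oI cw wC w0 wJ IJ wI) => //; rewrite /s; lra.
Qed.

(** * Solutions of the obstacle problem *)

Lemma within_continuous_comp (T1 T2 T3 : topologicalType) (A : set T2) (B : set T1)
    (f : T2 -> T3) (g : T1 -> T2) :
  continuous g -> (forall z, B z -> A (g z)) -> {within A, continuous f} ->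
  {within B, continuous (f \o g)}.
Proof.
move=> cg BA /subspace_continuousP cf; apply/subspace_continuousP => z Bz.
apply: (@cvg_comp _ _ _ g f _ (within A (nbhs (g z)))); last by apply: cf; exact: BA.
move=> P; rewrite /within /= => /cg; rewrite /nbhs /=; apply: filterS => y Hy By.
by apply: Hy; exact: BA.
Qed.

Lemma within_continuous_interior (T1 T2 : topologicalType) (A : set T1) (f : T1 -> T2) (z : T1) :
  nbhs z A -> {within A, continuous f} -> {for z, continuous f}.
Proof.
move=> zA /subspace_continuousP cf.
have := cf z (nbhs_singleton zA).
by rewrite within_interior.
Qed.

(** * The obstacle *)

Section psi.
Variables (R : realType) (K1 k1 K2 : R).
Hypothesis K1_gt0 : 0 < K1.

Lemma continuous_psi1 : continuous (psi1 K1 k1 K2).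
Proof.
move=> x; apply: cvgB; last exact: cvg_cst.
apply: cvgD; last exact: cvg_cst.
apply: (@continuous_max R _ (fun x : R => expR x - K1) (cst 0) x); last exact: cvg_cst.
by apply: cvgB; [exact: continuous_expR|exact: cvg_cst].
Qed.

Lemma psi1_ge x : K2 - k1 <= psi1 K1 k1 K2 x.
Proof. by rewrite /psi1 -addrA lerDr le_max lexx orbT. Qed.

Lemma psi1_le_ln x : x <= ln K1 -> psi1 K1 k1 K2 x = K2 - k1.
Proof.
move=> xK; rewrite /psi1 max_r ?add0r// subr_le0.
by rewrite -[leRHS](@lnK R) ?posrE// ler_expR.
Qed.

Lemma psi1_ge_ln x : ln K1 <= x -> psi1 K1 k1 K2 x = expR x + (K2 - k1 - K1).
Proof.
move=> xK; rewrite /psi1 max_l; first lra.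
by rewrite subr_ge0 -[leLHS](@lnK R) ?posrE// ler_expR.
Qed.

(** Integrated form of psi' <= e^x, the slope being 0 or e^x; it supplies the initial and lateral
    inequalities of [space_shift]. *)
Lemma psi1_slope x y : x <= y ->
  psi1 K1 k1 K2 y <= psi1 K1 k1 K2 x + (expR y - expR x).
Proof.
move=> xy; have exy : expR x <= expR y by rewrite ler_expR.
have [xK|/ltW xK] := lerP (ln K1) x.
  by rewrite !psi1_ge_ln//; [lra|exact: le_trans xy].
rewrite (psi1_le_ln xK); have [yK|/ltW yK] := lerP (ln K1) y; last by rewrite psi1_le_ln//; lra.
rewrite psi1_ge_ln//.
have : expR x <= K1 by rewrite -[leRHS](@lnK R) ?posrE// ler_expR.
lra.
Qed.

End psi.

(** The variational inequality with its almost-everywhere clauses replaced by local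
    approximability; [J] is the closure of [I]. *)
Definition obstacle_solution (R : realType) (a b r T : R) (psi : R -> R) (I J : set R)
    (u : R * R -> R) :=
  [/\ {within J `*` `[0, T], continuous u},
      forall x t, J x -> 0 <= t <= T -> psi x <= u (x, t),
      forall x, J x -> u (x, 0) = psi x,
      forall x t, I x -> 0 < t < T -> subsol a b r (fun z => - u z) (x, t) &
      forall x t, I x -> 0 < t < T -> psi x < u (x, t) -> subsol a b r u (x, t)].

Lemma cbox_sub_open (R : realType) (Om : set (R * R)) (z : R * R) : nbhs z Om ->
  exists2 d : R, 0 < d & cbox z (3 * d) `<=` Om.
Proof.
move=> /nbhs_ballP[d /= d0 Hd]; exists (d / 4); first lra.
move=> y /cboxP[h1 h2]; apply: Hd; apply/ball_prodE.
by rewrite distrC (distrC z.2); lra.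
Qed.

(** The boundary hypothesis covers both problems: in the capped case it concerns only [ln k1], where
    the obstacle equals [K2 - K1], and on the whole line it is void. *)
Lemma strong_obstacle_solution (R : realType) (K1 k1 K2 sigma r q T p : R) (I : set R)
    (u : R * R -> R) : 0 <= T -> open I ->
  (forall x t, closure I x -> ~ I x -> 0 <= t <= T -> u (x, t) = psi1 K1 k1 K2 x) ->
  strong_solution K1 k1 K2 sigma r q T p I u ->
  obstacle_solution (sigma ^+ 2 / 2) (r - q - sigma ^+ 2 / 2) r T (psi1 K1 k1 K2) I (closure I) u.
Proof.
move=> T0 oI bu [ux [uxx [ut [[cu wx wxx wt _] upsi ae1 ae2 u0]]]].
set a := sigma ^+ 2 / 2 in ae1 ae2 *; set b := r - q - a in ae1 ae2 *.
have nO x t : I x -> 0 < t < T -> nbhs (x, t) (I `*` `]0, T[).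
  move=> Ix t0; exists (I, `]0, T[%classic) => //=; split; first exact: open_nbhs_nbhs.
  by apply: open_nbhs_nbhs; split; [exact: itv_open|rewrite /= in_itv].
have OQ : I `*` `]0, T[ `<=` I `*` `]0, T].
  by move=> z [Iz]; rewrite /= !in_itv /= => zt; split => //=; lra.
have OC : I `*` `]0, T[ `<=` closure I `*` `[0, T].
  by move=> z [Iz]; rewrite /= !in_itv /= => zt; split => /=; [exact: subset_closure|lra].
have cO z : (I `*` `]0, T[) z -> {for z, continuous u}.
  case: z => x t [/= Ix]; rewrite in_itv /= => t0.
  by apply: within_continuous_interior cu; apply: filterS OC _; exact: nO.
split => //.
- move=> x t Jx tT; have [Ix|nIx] := pselect (I x); last by rewrite bu.
  have [t0|t0] := eqVneq t 0; first by rewrite t0 u0.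
  apply: (upsi (x, t)); split => //=; rewrite in_itv /= lt_neqAle eq_sym t0 /=; lra.
- move=> x Jx; have [Ix|nIx] := pselect (I x); first exact: u0.
  by apply: bu => //; rewrite lexx.
- move=> x t Ix t0.
  have [d d0 Hd] := cbox_sub_open (nO x t Ix t0).
  rewrite (_ : (fun z => - u z) = (fun z => -1 * u z)); last by apply/funext => z; rewrite mulN1r.
  apply: (weak_subsol d0 Hd wx wxx wt) => [z /Hd /cO//|].
  apply: (@filterS _ _ (ae_filter_ringOfSetsType (lebesgue2 R)) _ _ _ ae1) => z H /Hd/OQ Qz.
  by have := H Qz; lra.
- move=> x t Ix t0 ut0.
  (* By continuity the set where [u] exceeds the obstacle is open, so the almost everywhere equation
     is available on a whole box around (x, t). *)
  have cpsi : {for (x, t), continuous (fun z : R * R => u z - psi1 K1 k1 K2 z.1)}.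
    apply: cvgB.
      by apply: cO; split => //=; rewrite in_itv.
    by apply: continuous_fst_at; exact: continuous_psi1.
  have npos : nbhs (x, t) ((I `*` `]0, T[) `&` [set z | 0 < u z - psi1 K1 k1 K2 z.1]).
    apply: filterI; first exact: nO.
    by apply: (cvgr_gt _ cpsi); rewrite /= subr_gt0.
  have [d d0 Hd] := cbox_sub_open npos.
  rewrite (_ : u = (fun z => 1 * u z)); last by apply/funext => z; rewrite mul1r.
  apply: (weak_subsol d0 (subset_trans Hd (@subIsetl _ _ _)) wx wxx wt) => [z /Hd[/cO]//|].
  apply: (@filterS _ _ (ae_filter_ringOfSetsType (lebesgue2 R)) _ _ _ ae2) => z H /Hd[/OQ Qz /= zpsi].
  rewrite subr_gt0 in zpsi.
  by have := H Qz zpsi; lra.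
Qed.

(** Separate domains for [u] and [v] allow a half-line solution to be compared with a whole-line
    one, in both directions, and [T'] up to a shorter time. *)
Lemma order_solutions (R : realType) (a b r T T' C : R) (psi : R -> R) (I J Iu Ju Iv Jv : set R)
    (u v : R * R -> R) :
  0 <= a -> 0 <= r -> T' <= T -> closed J -> open I -> I `<=` J -> I `<=` Iu -> I `<=` Iv ->
  J `<=` Ju -> J `<=` Jv ->
  obstacle_solution a b r T psi Iu Ju u -> obstacle_solution a b r T psi Iv Jv v ->
  (forall x t, J x -> 0 <= t <= T' -> u (x, t) - v (x, t) <= C * expR `|x|) ->
  (forall x t, J x -> ~ I x -> 0 <= t <= T' -> u (x, t) <= v (x, t)) ->
  forall x t, J x -> 0 <= t <= T' -> u (x, t) <= v (x, t).
Proof.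
move=> a0 r0 T'T cJ oI IJ IIu IIv JJu JJv [cu _ u0 _ su] [cv vpsi v0 sv _] growth bd x t Jx tT.
rewrite -subr_le0.
apply: (@comparison R a b r T' C I J (fun z => u z - v z)) => //.
- have sub Jw : J `<=` Jw -> J `*` `[0, T'] `<=` Jw `*` `[0, T].
    by move=> JJw z [/= /JJw Jz]; rewrite in_itv /= => zt; split => //=; rewrite in_itv /=; lra.
  have c1 := continuous_subspaceW (sub _ JJu) cu.
  have c2 := continuous_subspaceW (sub _ JJv) cv.
  by move=> z; apply: cvgB; [exact: c1|exact: c2].
- by move=> y Jy; rewrite u0 ?v0 ?subrr//; [exact: JJv|exact: JJu].
- by move=> y s Jy nIy sT; rewrite subr_le0; exact: bd.
- move=> y s Iy sT; rewrite subr_gt0 => vu.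
  apply: subsol_viscosity => //; apply: subsolD.
    apply: su; [exact: IIu|lra|].
    by apply: le_lt_trans vu; apply: vpsi; [exact/JJv/IJ|lra].
  by apply: sv; [exact: IIv|lra].
Qed.

(** The later translate starts above psi, the initial value of [u], and has the same lateral values;
    where [u] exceeds it, [u] lies strictly above psi. *)
Lemma time_monotone (R : realType) (a b r T C : R) (psi : R -> R) (I J : set R)
    (u : R * R -> R) :
  0 <= a -> 0 <= r -> closed J -> open I -> I `<=` J ->
  obstacle_solution a b r T psi I J u ->
  (forall x t, J x -> 0 <= t <= T -> `|u (x, t)| <= C * expR `|x|) ->
  (forall x t, J x -> ~ I x -> 0 <= t <= T -> u (x, t) = psi x) ->
  forall x t t', J x -> 0 <= t <= t' -> t' <= T -> u (x, t) <= u (x, t').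
Proof.
move=> a0 r0 cJ oI IJ [cu upsi u0 su' su] growth bd x t t' Jx tt' t'T.
pose s := t' - t.
have s0 : 0 <= s by rewrite /s; lra.
rewrite -subr_le0.
have := @comparison R a b r (T - s) (2 * C) I J (fun z => u z - u (z.1 + 0, z.2 + s)) a0 r0 cJ oI IJ.
move=> /(_ _ _ _ _ _ x t Jx) /=; rewrite addr0 (_ : t + s = t'); last by rewrite /s; lra.
apply; last by rewrite /s; lra.
- have c1 : {within J `*` `[0, T - s], continuous u}.
    apply: continuous_subspaceW cu => z [/= Jz]; rewrite in_itv /= => zt.
    by split => //=; rewrite in_itv /=; lra.
  have c2 : {within J `*` `[0, T - s], continuous (u \o (fun z => (z.1 + 0, z.2 + s)))}.
    apply: within_continuous_comp cu.
      move=> z; apply: (@cvg_pair _ _ _ _ (nbhs (z.1 + 0)) (nbhs (z.2 + s))) => /=.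
        by apply: cvgD; [exact: cvg_fst|exact: cvg_cst].
      by apply: cvgD; [exact: cvg_snd|exact: cvg_cst].
    move=> z [/= Jz]; rewrite in_itv /= => zt.
    by split => /=; [rewrite addr0|rewrite in_itv /=; lra].
  by move=> z; apply: cvgB; [exact: c1|exact: c2].
- move=> y t1 Jy t1T; rewrite addr0.
  have := growth y t1 Jy; have := growth y (t1 + s) Jy.
  rewrite !ler_norml => g1 g2.
  have {}g1 := g1 (_ : 0 <= t1 + s <= T); have {}g2 := g2 (_ : 0 <= t1 <= T).
  by move: g1 g2 => /(_ ltac:(lra)) + /(_ ltac:(lra)); lra.
- move=> y Jy; rewrite addr0 add0r u0// subr_le0; apply: upsi => //; rewrite /s; lra.
- by move=> y t1 Jy nIy t1T; rewrite addr0 !bd ?subrr//; lra.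
- move=> y t1 Iy t1T; rewrite addr0 subr_gt0 => vu.
  apply: subsol_viscosity => //; apply: subsolD.
    apply: su => //; first lra.
    by apply: le_lt_trans vu; apply: upsi; [exact: IJ|lra].
  by apply: (@subsol_shift R a b r 0 s (fun z => - u z)); apply: su'; [rewrite addr0|lra].
Qed.

(** * Space translates, contact and extension *)

Lemma classical_expR (R : realType) (N : set (R * R)) (k c : R) :
  classical N (fun z => k * expR z.1 + c) (fun=> 0) (fun z => k * expR z.1) (fun z => k * expR z.1).
Proof.
move=> z Nz.
have d : is_derive z.1 (1 : R) (fun s : R => k * expR s) (k * expR z.1).
  exact: (is_deriveZ k (is_derive_expR z.1)).
split.
- apply: cvgD; last exact: cvg_cst.
  by apply: (@continuous_fst_at R (fun s => k * expR s)); exact: is_derive_continuous d.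
- exact: (is_derive_cst (k * expR z.1 + c)).
- have := is_deriveD d (is_derive_cst c z.1 1).
  by move/is_derive_eq; apply; rewrite addr0.
- exact: d.
Qed.

Lemma continuous_kexpR (R : realType) (k : R) (z : R * R) :
  {for z, continuous (fun y : R * R => k * expR y.1)}.
Proof.
apply: cvgM; first exact: cvg_cst.
by apply: continuous_fst_at; exact: continuous_expR.
Qed.

(** Letting [h] tend to 0, this is [d_x u <= e^x]: on the part of the line where [psi] has
    slope [e^x], [u - psi] is nonincreasing. *)
Lemma space_shift (R : realType) (a b r T C h : R) (psi : R -> R) (I J : set R)
    (u : R * R -> R) :
  0 <= a -> 0 <= r -> a + b <= r -> 0 < h -> closed J -> open I -> I `<=` J ->
  (forall x y, J x -> y < x -> I y) ->
  (forall x y, x <= y -> psi y <= psi x + (expR y - expR x)) ->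
  obstacle_solution a b r T psi I J u ->
  (forall x t, J x -> 0 <= t <= T -> `|u (x, t)| <= C * expR `|x|) ->
  (forall x t, J x -> ~ I x -> 0 <= t <= T -> u (x, t) = psi x) ->
  forall x t, J (x + h) -> 0 <= t <= T -> u (x + h, t) <= u (x, t) + (expR (x + h) - expR x).
Proof.
move=> a0 r0 abr h0 cJ oI IJ down slope [cu upsi u0 su' su] growth bd x t Jx tT.
(* Here e^(x + h) - e^x = k e^x, which d_t - L maps to (r - (a + b)) k e^x >= 0: adding it to [u]
   keeps a supersolution. *)
pose k := expR h - 1.
have k0 : 0 < k by rewrite subr_gt0 expR_gt1.
have kE y : expR (y + h) - expR y = k * expR y + 0 by rewrite /k expRD; ring.
have Jd y : J (y + h) -> J y by move=> Jy; apply/IJ/(down _ _ Jy); rewrite ltrDl.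
have cshift : continuous (fun y : R => y + h) by move=> y; apply: cvgD; [exact: cvg_id|exact: cvg_cst].
(* The domain is that of the translate. There u(y + h) and u(y) are both bounded by |C| e^h e^|y|,
   whence the constant. *)
have H := @comparison R a b r T (2 * `|C| * expR h) [set y | I (y + h)] [set y | J (y + h)]
  (fun z => u (z.1 + h, z.2 + 0) - u z - (k * expR z.1 + 0)) a0 r0.
have {}H := H _ _ _ _ _ _ _ _ x t Jx tT.
rewrite -subr_le0 opprD addrA kE -[X in u (_, X)]addr0.
apply: H.
- by move/continuous_closedP: cshift; apply.
- by move/continuousP: cshift; apply.
- by move=> y /= /IJ.
- have c1 : {within [set y | J (y + h)] `*` `[0, T], continuous u}.
    by apply: continuous_subspaceW cu => z [/= /Jd Jz].
  have c2 : {within [set y | J (y + h)] `*` `[0, T], continuous (u \o (fun z => (z.1 + h, z.2 + 0)))}.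
    apply: within_continuous_comp cu.
      move=> z; apply: (@cvg_pair _ _ _ _ (nbhs (z.1 + h)) (nbhs (z.2 + 0))) => /=.
        by apply: cvgD; [exact: cvg_fst|exact: cvg_cst].
      by apply: cvgD; [exact: cvg_snd|exact: cvg_cst].
    by move=> z [/= Jz zt]; split => //=; rewrite addr0.
  have c3 : {within [set y | J (y + h)] `*` `[0, T], continuous (fun z : R * R => k * expR z.1 + 0)}.
    apply: continuous_subspaceT => z; apply: cvgD; last exact: cvg_cst.
    exact: continuous_kexpR.
  by move=> z; apply: cvgB; [apply: cvgB; [exact: c2|exact: c1]|exact: c3].
- move=> y s /= Jy sT; rewrite !addr0.
  have := growth _ _ Jy sT; have := growth _ _ (Jd _ Jy) sT; rewrite !ler_norml => g1 g2.
  have e1 : C * expR `|y| <= `|C| * expR h * expR `|y|.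
    apply: (@le_trans _ _ (`|C| * expR `|y|)); first by rewrite ler_wpM2r ?expR_ge0// ler_norm.
    rewrite -mulrA ler_wpM2l//.
    by rewrite ler_peMl ?expR_ge0// -expR0 ler_expR ltW.
  have e2 : C * expR `|y + h| <= `|C| * expR h * expR `|y|.
    rewrite -mulrA -expRD; apply: (@le_trans _ _ (`|C| * expR `|y + h|)).
      by rewrite ler_wpM2r ?expR_ge0// ler_norm.
    by rewrite ler_wpM2l// ler_expR (le_trans (ler_normD _ _))// (gtr0_norm h0) addrC.
  have e3 : 0 <= k * expR y by apply: mulr_ge0; [exact: ltW|exact: expR_ge0].
  lra.
- move=> y /= Jy; rewrite !addr0 -(addr0 (k * _)) -kE !u0//; last exact: Jd.
  by have := slope y (y + h); rewrite lerDl (ltW h0) => /(_ isT); lra.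
- move=> y s /= Jy nIy sT; rewrite !addr0 bd// -(addr0 (k * _)) -kE.
  have := upsi y s (Jd _ Jy) sT.
  by have := slope y (y + h); rewrite lerDl (ltW h0) => /(_ isT); lra.
- move=> y s /= Iy sT; rewrite !addr0 -(addr0 (k * _)) -kE => vu.
  have Iyy : I y by apply: (down _ _ (IJ _ Iy)); rewrite ltrDl.
  apply: (@viscosity_subsolB R a b r 1 (fun z => u (z.1 + h, z.2 + 0) + - u z) _ (fun z => k * expR z.1 + 0)
    (fun=> 0) (fun z => k * expR z.1) (fun z => k * expR z.1)).
  + exact: ltr01.
  + apply: subsol_viscosity => //; apply: subsolD; last by apply: su' => //; lra.
    apply: (@subsol_shift R a b r h 0 u); rewrite addr0; apply: su => //.
    (* In the region of violation u(y + h) > psi(y) + e^(y + h) - e^y >= psi(y + h), so the equation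
       holds at the translated point. *)
    have := slope y (y + h); rewrite lerDl (ltW h0) => /(_ isT).
    have := upsi y s (IJ _ Iyy); move: vu; lra.
  + exact: classical_expR.
  + exact: cvg_cst.
  + exact: continuous_kexpR.
  + exact: continuous_kexpR.
  + rewrite /= addr0 (_ : _ - _ = (r - (a + b)) * (k * expR y)); last by ring.
    by apply: mulr_ge0; [lra|apply: mulr_ge0; [exact: ltW|exact: expR_ge0]].
  + by move=> z _.
  + by [].
Qed.

Lemma classical_quadratic (R : realType) (N : set (R * R)) (m x1 c : R) :
  classical N (fun z => m * (z.1 - x1) ^+ 2 + c) (fun=> 0) (fun z => m * (2 * (z.1 - x1)))
    (fun=> m * 2).
Proof.
move=> z Nz.
have d : is_derive z.1 (1 : R) (fun s : R => m * (s - x1) ^+ 2) (m * (2 * (z.1 - x1))).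
  exact: (is_deriveZ m (is_derive_sqrB x1 z.1)).
split.
- apply: cvgD; last exact: cvg_cst.
  by apply: (@continuous_fst_at R (fun s => m * (s - x1) ^+ 2)); exact: is_derive_continuous d.
- exact: (is_derive_cst (m * (z.1 - x1) ^+ 2 + c)).
- have := is_deriveD d (is_derive_cst c z.1 1).
  by move/is_derive_eq; apply; rewrite addr0.
- have d1 : is_derive z.1 (1 : R) (fun s : R => s - x1) 1.
    by apply: is_derive_eq; rewrite subr0.
  have := is_deriveZ m (is_deriveZ 2 d1).
  by move/is_derive_eq; apply; rewrite /GRing.scale /= mulr1.
Qed.

Lemma classical_cst (R : realType) (N : set (R * R)) (c : R) :
  classical N (fun=> c) (fun=> 0) (fun=> 0) (fun=> 0).
Proof. by move=> z Nz; split; [exact: cvg_cst|exact: is_derive_cst..]. Qed.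

(** The barrier is [c + m * max(x - x1, 0) ^ 2]; the condition on [m] makes the quadratic a
    supersolution, [b ^ 2 / r] being the maximum of [2 * b * y - r * y ^ 2]. *)
Lemma lower_contact (R : realType) (a b r T T' C c m l x1 : R) (psi : R -> R) (I J : set R)
    (u : R * R -> R) :
  0 <= a -> 0 < r -> T' <= T -> 0 <= m -> m * (2 * a + b ^+ 2 / r) <= r * c ->
  (forall x, x <= l -> I x) -> I `<=` J -> (forall x, x <= l -> psi x = c) ->
  obstacle_solution a b r T psi I J u ->
  (forall x t, J x -> 0 <= t <= T -> `|u (x, t)| <= C * expR `|x|) ->
  x1 <= l ->
  (forall t, 0 <= t <= T' -> u (l, t) <= c + m * (l - x1) ^+ 2) ->
  forall x t, x <= x1 -> 0 <= t <= T' -> u (x, t) = c.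
Proof.
move=> a0 r0 T'T m0 mc lI IJ psic [cu upsi u0 _ su] growth x1l ul x t xx1 tT.
apply/eqP; rewrite eq_le; apply/andP; split; last first.
  by rewrite -(psic x) ?upsi//; [exact/IJ/lI/le_trans/x1l|lra|exact: le_trans x1l].
pose g (y : R) := m * (Num.max (y - x1) 0) ^+ 2 + c.
have g_ge y : c <= g y by rewrite lerDr; apply: mulr_ge0 => //; exact: sqr_ge0.
have gl y : y <= x1 -> g y = c.
  by move=> yx; rewrite /g max_r ?subr_le0// expr0n mulr0 add0r.
have gr y : x1 <= y -> g y = m * (y - x1) ^+ 2 + c.
  by move=> yx; rewrite /g max_l ?subr_ge0.
have cg : continuous g.
  move=> y; apply: cvgD; last exact: cvg_cst.
  apply: cvgM; first exact: cvg_cst.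
  have cm : {for y, continuous (fun y : R => Num.max (y - x1) 0)}.
    apply: (@continuous_max R _ (fun y : R => y - x1) (cst 0) y); last exact: cvg_cst.
    by apply: cvgB; [exact: cvg_id|exact: cvg_cst].
  by apply: (@cvgM _ _ _ _ _ _ _ _ cm cm).
rewrite -subr_le0 -(gl _ xx1).
have r0' := ltW r0.
apply: (@comparison R a b r T' C `]-oo, l[ `]-oo, l] (fun z => u z - g z.1)) => //=.
- by move=> y; rewrite /= !in_itv /=; exact: ltW.
- have c1 : {within `]-oo, l] `*` `[0, T'], continuous u}.
    apply: continuous_subspaceW cu => z [/=]; rewrite !in_itv /= => zl zt.
    by split => //=; [exact/IJ/lI|lra].
  have c2 : {within `]-oo, l] `*` `[0, T'], continuous (fun z : R * R => g z.1)}.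
    by apply: continuous_subspaceT => z; apply: continuous_fst_at; exact: cg.
  by move=> z; apply: cvgB; [exact: c1|exact: c2].
- move=> y s; rewrite in_itv /= => yl sT.
  have := growth y s (IJ _ (lI _ yl)); rewrite ler_norml => /(_ ltac:(lra)).
  have := g_ge y; have c0 : 0 <= c; last lra.
  rewrite -(pmulr_rge0 _ r0); apply: le_trans mc; apply: mulr_ge0 => //.
  by apply: addr_ge0; [lra|apply: divr_ge0 => //; exact: sqr_ge0].
- move=> y; rewrite in_itv /= => yl; rewrite u0; last exact/IJ/lI.
  by rewrite psic// subr_le0.
- move=> y s; rewrite !in_itv /= => yl /negP; rewrite -leNgt => ly sT.
  have -> : y = l by apply/eqP; rewrite eq_le yl.
  by rewrite subr_le0 gr// addrC; exact: ul.
- move=> y s; rewrite in_itv /= => yl sT; rewrite subr_gt0 => gu.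
  have Vu : viscosity_subsol a b r u (y, s).
    apply: subsol_viscosity => //; apply: su; [exact/lI/ltW|lra|].
    by rewrite psic ?(ltW yl)//; apply: le_lt_trans gu.
  (* [g] need not be twice differentiable at [x1]. The whole parabola lies above it and meets it on
     x >= x1, which is all that [viscosity_subsolB] asks; to the left of [x1] the constant
     serves. *)
  have [yx|xy] := ltP y x1.
  + have d0 : 0 < x1 - y by rewrite subr_gt0.
    apply: (@viscosity_subsolB R a b r _ u _ (fun=> c) (fun=> 0) (fun=> 0) (fun=> 0) (y, s) d0 Vu).
    * exact: classical_cst.
    * exact: cvg_cst.
    * exact: cvg_cst.
    * exact: cvg_cst.
    * rewrite !mulr0 addr0 sub0r sub0r opprK; apply: le_trans mc; apply: mulr_ge0 => //.
      by apply: addr_ge0; [lra|apply: divr_ge0 => //; exact: sqr_ge0].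
    * move=> z /ball_prodE[/= z1 _]; rewrite gl//; move: z1; rewrite ltr_norml; lra.
    * by rewrite /= gl// ltW.
  + apply: (@viscosity_subsolB R a b r 1 u _ (fun z => m * (z.1 - x1) ^+ 2 + c) (fun=> 0)
      (fun z => m * (2 * (z.1 - x1))) (fun=> m * 2) (y, s) ltr01 Vu).
    * exact: classical_quadratic.
    * exact: cvg_cst.
    * apply: cvgM; first exact: cvg_cst.
      apply: cvgM; first exact: cvg_cst.
      by apply: cvgB; [exact: cvg_fst|exact: cvg_cst].
    * exact: cvg_cst.
    * rewrite /= sub0r.
      have sq : 0 <= m * (r * (y - x1 - b / r) ^+ 2).
        by apply: mulr_ge0 => //; apply: mulr_ge0 => //; exact: sqr_ge0.
      have E : m * (r * (y - x1 - b / r) ^+ 2) = m * (r * (y - x1) ^+ 2 - 2 * b * (y - x1) + b ^+ 2 / r).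
        by field; rewrite gt_eqF.
      move: sq mc; rewrite E; lra.
    * move=> z _; rewrite lerD2l lerN2 /g lerD2r ler_wpM2l//.
      have [zx|zx] := leP x1 z.1; first by rewrite max_l ?subr_ge0.
      by rewrite max_r ?subr_le0 ?(ltW zx)// expr0n sqr_ge0.
    * by rewrite /= gr.
- by rewrite in_itv /=; exact: le_trans x1l.
Qed.

(** [u] continued by [psi] beyond [be] is a supersolution on the whole line: the contact on
    [[x0, be]] forces the sign of [- L psi] there, hence, by monotonicity, on [[be, +oo[]. *)
Lemma capped_extension (R : realType) (a b r T C k be x0 t0 : R) (psi : R -> R)
    (u v : R * R -> R) :
  0 <= a -> 0 < r -> a + b <= r -> 0 < t0 <= T -> x0 < be ->
  continuous psi -> (forall x, 0 <= psi x) ->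
  (forall x, x0 <= x -> psi x = expR x + k) ->
  obstacle_solution a b r T psi `]-oo, be[ `]-oo, be] u ->
  obstacle_solution a b r T psi setT setT v ->
  (forall x t, 0 <= t <= T -> `|v (x, t)| <= C * expR `|x|) ->
  (forall x t, x0 <= x <= be -> 0 <= t <= t0 -> u (x, t) = psi x) ->
  v (x0, t0) <= u (x0, t0).
Proof.
move=> a0 r0 abr t00 x0be cpsi psi0 psiE [cu upsi u0 su' _] [cv vpsi v0 _ sv] growth upsiE.
have r0' := ltW r0.
have Ibe y : y < be -> `]-oo, be[%classic y by move=> ?; rewrite /= in_itv.
have Jbe y : y <= be -> `]-oo, be]%classic y by move=> ?; rewrite /= in_itv.
(* Minimum and maximum write the extension as one continuous formula: [u] up to [be], and beyond it
   u(be, t) + psi(x) - psi(be), which is psi(x) by contact. *)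
pose U (z : R * R) := u (Num.min z.1 be, z.2) + (psi (Num.max z.1 be) - psi be).
have Ul x t : x <= be -> U (x, t) = u (x, t).
  by move=> xb; rewrite /U /= min_l// max_r// subrr addr0.
have Ur x t : x0 <= x -> 0 <= t <= t0 -> U (x, t) = psi x.
  move=> xx0 tt0; have [xb|/ltW xb] := leP x be; first by rewrite Ul// upsiE// xx0.
  by rewrite /U /= min_r// max_l// upsiE ?lexx ?(ltW x0be)//; lra.
have Upsi x t : 0 <= t <= t0 -> psi x <= U (x, t).
  move=> tt0; have [xb|/ltW xb] := leP x be; first by rewrite Ul//; apply: upsi; [exact: Jbe|lra].
  by rewrite Ur//; lra.
have sup x : be <= x -> 0 <= r * k + (r - (a + b)) * expR x.
  move=> bx; pose y := (x0 + be) / 2.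
  have yx : expR y <= expR x by rewrite ler_expR /y; lra.
  suff : 0 <= r * k + (r - (a + b)) * expR y.
    have : (r - (a + b)) * expR y <= (r - (a + b)) * expR x by rewrite ler_wpM2l//; lra.
    lra.
  (* The midpoint [y] of the contact interval has a ball around it on which [u] equals e^x + k.
     Testing [- u] with the opposite of e^x + k turns the supersolution property into the sign of -L
     psi at [y]. *)
  have Vu : viscosity_subsol a b r (fun z => - u z) (y, t0 / 2).
    by apply: subsol_viscosity => //; apply: su'; [apply: Ibe; rewrite /y; lra|lra].
  pose d := Num.min ((be - x0) / 2) (t0 / 2).
  have d0 : 0 < d by rewrite lt_min; lra.
  have d1 : d <= (be - x0) / 2 by rewrite ge_min lexx.
  have d2 : d <= t0 / 2 by rewrite ge_min lexx orbT.
  have := Vu d _ _ _ _ d0 (@classical_expR R _ (-1) (- k)).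
  move=> /(_ (cvg_cst _)) /(_ (@continuous_kexpR R (-1) _)) /(_ (@continuous_kexpR R (-1) _)) H.
  have : 0 - (a * (-1 * expR y) + b * (-1 * expR y) - r * - u (y, t0 / 2)) <= 0.
    apply: H => z zb.
    have uE w : ball (y, t0 / 2) d w -> u w = expR w.1 + k.
      case: w => w1 w2 /ball_prodE[/=]; rewrite !ltr_norml => w1y w2t.
      by rewrite upsiE ?psiE//; move: w1y w2t; rewrite /y; lra.
    rewrite (uE _ zb) (uE (y, t0 / 2)); last exact: ballxx.
    by rewrite /=; lra.
  rewrite upsiE ?psiE; rewrite /y; lra.
rewrite -(Ul _ _ (ltW x0be)) -subr_le0.
apply: (@comparison R a b r t0 C setT setT (fun z => v z - U z)) => //.
- exact: openT.
- have c1 : {within setT `*` `[0, t0], continuous v}.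
    apply: continuous_subspaceW cv => z [_ /=]; rewrite in_itv /= => zt.
    by split => //=; rewrite in_itv /=; lra.
  have c2 : {within setT `*` `[0, t0], continuous (u \o (fun z => (Num.min z.1 be, z.2)))}.
    apply: within_continuous_comp cu.
      move=> z; apply: (@cvg_pair _ _ _ _ (nbhs (Num.min z.1 be)) (nbhs z.2)) => /=.
        apply: (@continuous_min R _ (fun z : R * R => z.1) (cst be) z); last exact: cvg_cst.
        exact: cvg_fst.
      exact: cvg_snd.
    move=> z [_ /=]; rewrite in_itv /= => zt.
    by split => /=; rewrite in_itv /=; [rewrite ge_min lexx orbT|lra].
  have c3 : {within setT `*` `[0, t0], continuous (fun z : R * R => psi (Num.max z.1 be) - psi be)}.
    apply: continuous_subspaceT => z; apply: cvgB; last exact: cvg_cst.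
    apply: (@continuous_comp _ _ _ (fun z : R * R => Num.max z.1 be) psi); last exact: cpsi.
    apply: (@continuous_max R _ (fun z : R * R => z.1) (cst be) z); last exact: cvg_cst.
    exact: cvg_fst.
  by move=> z; apply: cvgB; [exact: c1|apply: cvgD; [exact: c2|exact: c3]].
- move=> x t _ tt0; have := growth x t; rewrite ler_norml => /(_ ltac:(lra)).
  have := Upsi x t tt0; have := psi0 x; lra.
- by move=> x _; rewrite v0// subr_le0 Upsi// lexx; lra.
- move=> x t _ tt0; rewrite subr_gt0 => Uv.
  have sv' : subsol a b r v (x, t).
    by apply: sv => //; [lra|apply: le_lt_trans Uv; apply: Upsi; lra].
  have [xb|bx] := ltP x be.
    apply: subsol_viscosity => //; apply: subsolD => //.
    apply: (@subsol_near R a b r (fun z => - u z) _ _ (be - x)); first by rewrite subr_gt0.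
      move=> [z1 z2] /ball_prodE[/=]; rewrite ltr_norml => z1x _.
      by rewrite Ul//; lra.
    by apply: su'; [exact: Ibe|lra].
  (* This case includes [x = be]: contact on [x0, be] makes [U] equal to e^x + k on both sides, so
     the gluing creates no kink. The radius also keeps the ball within the times at which contact is
     known. *)
  pose d := Num.min (be - x0) (Num.min t (t0 - t)).
  have d0 : 0 < d by rewrite !lt_min; lra.
  have [d1 d2 d3] : [/\ d <= be - x0, d <= t & d <= t0 - t].
    by split; rewrite !ge_min lexx ?orbT.
  have UE w : ball (x, t) d w -> U w = 1 * expR w.1 + k.
    case: w => w1 w2 /ball_prodE[/=]; rewrite !ltr_norml => w1y w2t.
    by rewrite Ur ?psiE ?mul1r//; lra.
  apply: (@viscosity_subsolB R a b r d v _ (fun z => 1 * expR z.1 + k) (fun=> 0)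
    (fun z => 1 * expR z.1) (fun z => 1 * expR z.1)) => //.
  + exact: subsol_viscosity.
  + exact: classical_expR.
  + exact: cvg_cst.
  + exact: continuous_kexpR.
  + exact: continuous_kexpR.
  + by have := sup x bx; rewrite /= !mul1r; lra.
  + by move=> z zb; rewrite UE.
  + by rewrite UE//; exact: ballxx.
- by lra.
Qed.

(** * Free boundaries *)

Lemma closure_lray (R : realType) (b : R) : closure `]-oo, b[%classic = `]-oo, b]%classic.
Proof.
apply/seteqP; split => [|x].
  rewrite [X in _ `<=` X](iffLR (closure_id _) (@lray_closed _ _ b)).
  by apply: closure_subset => y; rewrite /= !in_itv /=; exact: ltW.
rewrite /= in_itv /= => xb B /nbhs_ballP[e /= e0 He].
exists (x - e / 2); split; first by rewrite /= in_itv /=; lra.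
by apply: He; rewrite /ball /= opprB addrC subrK gtr0_norm; lra.
Qed.

Lemma closed_is_max (R : realType) (S : set R) : closed S -> S !=set0 -> has_ubound S ->
  is_max S (sup S).
Proof.
move=> cS S0 Sb; split; last exact: ub_le_sup.
by have := closure_sup S0 Sb; rewrite -(iffLR (closure_id _) cS).
Qed.

Lemma is_max_unique (R : realType) (S : set R) (x y : R) : is_max S x -> is_max S y -> x = y.
Proof. by move=> [Sx xS] [Sy yS]; apply/eqP; rewrite eq_le yS// xS. Qed.

Lemma continuous_section (R : realType) (T t : R) (u : R * R -> R) : 0 <= t <= T ->
  {within setT `*` `[0, T], continuous u} -> continuous (fun x => u (x, t)).
Proof.
move=> tT cu; have : {within [set: R], continuous (u \o (fun x : R => (x, t)))}.
  apply: within_continuous_comp cu.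
    by move=> x; apply: (@cvg_pair _ _ _ _ (nbhs x) (nbhs t)) => /=; [exact: cvg_id|exact: cvg_cst].
  by move=> x _; split => //=; rewrite in_itv.
move=> /subspace_continuousP H x P PP.
have HP : nbhs x [set y | setT y -> P (u (y, t))] := H x I P PP.
have HP' : nbhs x [set y | P (u (y, t))] by apply: filterS HP => y; apply.
exact: HP'.
Qed.

Lemma within_segment_near (R : realType) (T s e : R) (J : set R) (u : R * R -> R) (x : R) :
  {within J `*` `[0, T], continuous u} -> J x -> 0 <= s <= T -> 0 < e ->
  exists2 d : R, 0 < d & forall t, 0 <= t <= T -> `|s - t| < d -> `|u (x, s) - u (x, t)| < e.
Proof.
move=> /subspace_continuousP cu Jx sT e0.
have Kxs : (J `*` `[0, T]) (x, s) by split => //=; rewrite in_itv.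
have /cvgrPdist_lt/(_ _ e0) := cu _ Kxs.
rewrite near_withinE => /nbhs_ballP[d /= d0 Hd]; exists d => // t tT std.
apply: Hd; last by split => //=; rewrite in_itv.
by apply/ball_prodE; rewrite /= subrr normr0.
Qed.

Section FreeBoundaries.
Variables (R : realType) (K1 k1 K2 a b r T : R) (Y V : R * R -> R) (C M : R).
Hypotheses (K1_gt0 : 0 < K1) (K1_lt_k1 : K1 < k1) (k1_lt_K2 : k1 < K2) (a_ge0 : 0 <= a)
  (r_gt0 : 0 < r) (abr : a + b <= r) (T_gt0 : 0 < T).

Local Notation psi := (psi1 K1 k1 K2).
Local Notation be := (ln k1).
Local Notation l := (ln K1).
Local Notation Binf := (uncapped_upper_free_boundary K1 k1 K2 V).
Local Notation taus := (tau_star k1 T Binf).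

Hypotheses (solY : obstacle_solution a b r T psi `]-oo, be[ `]-oo, be] Y)
  (solV : obstacle_solution a b r T psi setT setT V)
  (bdY : forall t, 0 <= t <= T -> Y (be, t) = psi be)
  (growthY : forall x t, x <= be -> 0 <= t <= T -> `|Y (x, t)| <= M)
  (growthV : forall x t, 0 <= t <= T -> `|V (x, t)| <= C * expR `|x|).

Let r_ge0 : 0 <= r. Proof. exact: ltW. Qed.
Let l_lt_be : l < be. Proof. by rewrite ltr_ln// posrE; exact: lt_trans K1_lt_k1. Qed.
Let psi_ge0 x : 0 <= psi x.
Proof. by apply: le_trans (psi1_ge K1 k1 K2 x); rewrite subr_ge0 ltW. Qed.

Let inJ x : x <= be -> `]-oo, be]%classic x. Proof. by move=> ?; rewrite /= in_itv. Qed.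
Let onb x : `]-oo, be]%classic x -> ~ `]-oo, be[%classic x -> x = be.
Proof.
rewrite /= !in_itv /= => xb /negP; rewrite -leNgt => bx.
by apply/eqP; rewrite eq_le xb.
Qed.

Let M_ge0 : 0 <= M.
Proof. by apply: le_trans (growthY (lexx be) (_ : 0 <= 0 <= T)) => //; rewrite lexx ltW. Qed.

Let bound_le (x : R) : M <= M * expR `|x|.
Proof. by rewrite ler_peMr// -expR0 ler_expR. Qed.

Let growthY' x t : `]-oo, be]%classic x -> 0 <= t <= T -> `|Y (x, t)| <= M * expR `|x|.
Proof. by rewrite /= in_itv /= => xb tT; apply: le_trans (bound_le x); exact: growthY. Qed.

Let bdY' x t : `]-oo, be]%classic x -> ~ `]-oo, be[%classic x -> 0 <= t <= T ->
  Y (x, t) = psi x.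
Proof. by move=> Jx /(onb Jx) ->; exact: bdY. Qed.

Let Ypsi x t : x <= be -> 0 <= t <= T -> psi x <= Y (x, t).
Proof. by move=> xb tT; have [_ H _ _ _] := solY; apply: H => //; exact: inJ. Qed.

Let Vpsi x t : 0 <= t <= T -> psi x <= V (x, t).
Proof. by move=> tT; have [_ H _ _ _] := solV; exact: H. Qed.

(** * Order of the two solutions, propagation of contact, monotonicity in time *)

Lemma capped_le_uncapped x t : x <= be -> 0 <= t <= T -> Y (x, t) <= V (x, t).
Proof.
move=> xb tT.
apply: (@order_solutions R a b r T T M psi `]-oo, be[ `]-oo, be] `]-oo, be[ `]-oo, be] setT setT) => //.
- by move=> y; rewrite /= !in_itv /=; exact: ltW.
- move=> y s Jy sT; have := growthY' Jy sT; rewrite ler_norml.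
  by have := Vpsi y sT; have := psi_ge0 y; lra.
- by move=> y s Jy nIy sT; rewrite bdY'//; exact: Vpsi.
Qed.

(** To the right of [ln K1] the increment e^y - e^x allowed by [space_shift] is exactly that of
    psi. *)
Lemma capped_contact_up x y t : l <= x -> x <= y -> y <= be -> 0 <= t <= T ->
  Y (x, t) = psi x -> Y (y, t) = psi y.
Proof.
move=> lx xy yb tT Yx; apply/eqP; rewrite eq_le Ypsi// andbT.
have [E|xy'] := eqVneq x y; first by rewrite -E Yx.
have E : x + (y - x) = y by rewrite addrC subrK.
have := @space_shift R a b r T M (y - x) psi `]-oo, be[ `]-oo, be] Y a_ge0 r_ge0 abr.
move=> /(_ _ _ _ _ _ _ solY growthY' bdY' x t); rewrite E => H.
have {}H : Y (y, t) <= Y (x, t) + (expR y - expR x).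
  apply: H => //.
  - by rewrite subr_gt0 lt_neqAle xy'.
  - by move=> z; rewrite /= !in_itv /=; exact: ltW.
  - by move=> z w; rewrite /= !in_itv /= => zb wz; exact: lt_le_trans zb.
  - by move=> z w; exact: psi1_slope.
move: H; rewrite Yx !psi1_ge_ln//; [lra|exact: le_trans xy].
Qed.

Lemma uncapped_contact_up x y t : l <= x -> x <= y -> 0 <= t <= T ->
  V (x, t) = psi x -> V (y, t) = psi y.
Proof.
move=> lx xy tT Vx; apply/eqP; rewrite eq_le Vpsi// andbT.
have [E|xy'] := eqVneq x y; first by rewrite -E Vx.
have E : x + (y - x) = y by rewrite addrC subrK.
have := @space_shift R a b r T C (y - x) psi setT setT V a_ge0 r_ge0 abr.
move=> /(_ _ _ _ _ _ _ solV _ _ x t); rewrite E => H.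
have {}H : V (y, t) <= V (x, t) + (expR y - expR x).
  apply: H => //.
  - by rewrite subr_gt0 lt_neqAle xy'.
  - exact: openT.
  - by move=> z w; exact: psi1_slope.
  - by move=> z s _; exact: growthV.
move: H; rewrite Vx !psi1_ge_ln//; [lra|exact: le_trans xy].
Qed.

Lemma capped_monotone x s t : x <= be -> 0 <= s <= t -> t <= T -> Y (x, s) <= Y (x, t).
Proof.
move=> xb st tT; apply: (time_monotone a_ge0 r_ge0 _ _ _ solY growthY' bdY') => //.
by move=> y; rewrite /= !in_itv /=; exact: ltW.
Qed.

Lemma uncapped_monotone x s t : 0 <= s <= t -> t <= T -> V (x, s) <= V (x, t).
Proof.
move=> st tT; apply: (@time_monotone R a b r T C psi setT setT V) => //.
- exact: openT.
- by move=> y w _; exact: growthV.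
Qed.

(** [x < be] is strict because at [be] contact is imposed by the boundary condition and reveals
    nothing about -L psi. Contact at (x, t) fills [x, be] times [0, t], as [capped_extension]
    requires. *)
Lemma contact_transfer x t : l <= x -> x < be -> 0 < t <= T -> Y (x, t) = psi x ->
  V (x, t) = psi x.
Proof.
move=> lx xb tT Yx; apply/eqP; rewrite eq_le Vpsi ?andbT; last lra.
rewrite -Yx; apply: (@capped_extension R a b r T C (K2 - k1 - K1) be x t psi Y V) => //.
- exact: continuous_psi1.
- by move=> y xy; apply: psi1_ge_ln => //; exact: le_trans xy.
- move=> y s /andP[xy yb] st; apply/eqP; rewrite eq_le Ypsi ?andbT//; last lra.
  apply: (@le_trans _ _ (Y (y, t))); first by apply: capped_monotone => //; lra.
  by rewrite (capped_contact_up lx xy yb _ Yx)//; lra.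
Qed.

(** From psi <= Y <= V, contact of [V] up to [be] is contact of [Y], so [B t] is at most both terms.
    Conversely, either [B t] is [be], or its contact transfers to [V]. *)
Lemma upper_boundary (B : R -> R) t : capped_upper_free_boundary K1 k1 K2 T Y B ->
  0 < t <= T -> (B t)%:E = Order.min (Binf t) be%:E.
Proof.
move=> HB tT; have [[/andP[lB Bb] YB] Bmin] := HB t tT.
have tT' : 0 <= t <= T by lra.
apply/eqP; rewrite eq_le; apply/andP; split.
  rewrite le_min; apply/andP; split; last by rewrite lee_fin.
  apply: le_ereal_inf_tmp => _ [x [lx Vx] <-]; rewrite lee_fin.
  have [xb|/ltW bx] := leP x be; last exact: le_trans Bb bx.
  apply: Bmin; split; first by rewrite lx.
  by apply/eqP; rewrite eq_le -{1}Vx capped_le_uncapped//= Ypsi.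
have [Bb'|bB] := ltP (B t) be; last by rewrite ge_min lee_fin bB orbT.
rewrite ge_min; apply/orP; left; apply: ereal_inf_lbound; exists (B t) => //.
by split => //; exact: contact_transfer.
Qed.

(** The infimum may be approached from beyond [be]. If psi < V held at [be], it would hold on a
    ball, which contact propagating to the right would have to enter. *)
Lemma uncapped_contact_cap t : 0 < t <= T -> (Binf t <= be%:E)%E -> V (be, t) = psi be.
Proof.
move=> tT Bb; have tT' : 0 <= t <= T by lra.
apply/eqP; rewrite eq_le Vpsi// andbT leNgt; apply/negP => psiV.
have [cV _ _ _ _] := solV.
have cd : {for be, continuous (fun x => V (x, t) - psi x)}.
  by apply: cvgB; [exact: (continuous_section tT' cV)|exact: continuous_psi1].
have : \forall x \near be, 0 < V (x, t) - psi x by apply: cvgr_gt cd _ _; rewrite subr_gt0.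
move=> /nbhs_ballP[e /= e0 He].
suff : ((be + e / 2)%:E <= Binf t)%E by move=> /le_trans /(_ Bb); rewrite lee_fin; lra.
apply: le_ereal_inf_tmp => _ [x [lx Vx] <-]; rewrite lee_fin leNgt; apply/negP => xe.
pose y := Num.max x be.
have xy : x <= y by rewrite le_max lexx.
have yb : be <= y by rewrite le_max lexx orbT.
have ye : y < be + e / 2 by rewrite gt_max xe; lra.
have := He y; rewrite /ball /= (uncapped_contact_up lx xy tT' Vx) subrr ltxx => H.
have : false by apply: H; rewrite distrC ger0_norm; lra.
by [].
Qed.

(** One time [s] suffices: V(be, t) <= V(be, s) = psi(be) at all earlier times, so the comparison
    can be run with the roles of [Y] and [V] exchanged. *)
Lemma capped_eq_uncapped_before x s t : 0 < s <= T -> (Binf s <= be%:E)%E ->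
  x <= be -> 0 <= t <= s -> Y (x, t) = V (x, t).
Proof.
move=> sT Bb xb ts; apply/eqP; rewrite eq_le capped_le_uncapped//=; last lra.
have Vs := uncapped_contact_cap sT Bb.
apply: (@order_solutions R a b r T s C psi `]-oo, be[ `]-oo, be] setT setT `]-oo, be[ `]-oo, be]) => //.
- lra.
- by move=> y; rewrite /= !in_itv /=; exact: ltW.
- move=> y w; rewrite /= in_itv /= => yb ws.
  have := growthV y (_ : 0 <= w <= T); rewrite ler_norml => /(_ ltac:(lra)).
  by have := Ypsi yb (_ : 0 <= w <= T); have := psi_ge0 y; move=> ? /(_ ltac:(lra)); lra.
- move=> y w Jy /(onb Jy) -> ws; rewrite bdY; last lra.
  by rewrite -Vs; apply: uncapped_monotone; lra.
Qed.

Lemma tau_star_le : taus <= T.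
Proof.
rewrite /tau_star; have [S0|S0] := pselect ([set t | 0 < t <= T /\ (Binf t <= (ln k1)%:E)%E] !=set0).
  by apply: ge_sup => // t [/andP[]].
by rewrite sup_out; [exact: ltW|case].
Qed.

(** Without knowing that the supremum is attained, the time [tau_star] itself is reached as a limit
    of earlier times, by continuity of both solutions. *)
Lemma capped_eq_uncapped x t : x <= be -> 0 <= t <= taus -> Y (x, t) = V (x, t).
Proof.
move=> xb ttau; have tauT := tau_star_le.
have [cY _ Y0 _ _] := solY; have [cV _ V0 _ _] := solV.
have before s : 0 <= s < taus -> Y (x, s) = V (x, s).
  move=> stau; set S := [set t | 0 < t <= T /\ (Binf t <= (ln k1)%:E)%E].
  (* Otherwise [sup] would take its default value 0, and no nonnegative time would lie below it. *)
  have hS : has_sup S.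
    apply: contrapT => /sup_out; rewrite -/(tau_star k1 T Binf); lra.
  have stau0 : 0 < taus - s by lra.
  have [s' [s'T Bs']] := sup_adherent stau0 hS.
  rewrite -/(tau_star k1 T Binf) opprB addrC subrK => ss'.
  by apply: capped_eq_uncapped_before s'T Bs' xb _; lra.
have [tt|] := ltP t taus; first by apply: before; lra.
move=> taut; have {taut} E : t = taus by lra.
have [t0|t0] := eqVneq t 0; first by rewrite t0 Y0 ?V0//; exact: inJ.
have tp : 0 < t by rewrite lt_neqAle eq_sym t0; lra.
have tT : 0 <= t <= T by lra.
apply/eqP; rewrite -subr_eq0; apply/negPn/negP => Dn0.
pose e := `|Y (x, t) - V (x, t)| / 2.
have e0 : 0 < e by apply: divr_gt0 => //; rewrite normr_gt0.
have [d1 d10 H1] := within_segment_near cY (inJ xb) tT e0.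
have [d2 d20 H2] := within_segment_near cV (I : setT x) tT e0.
pose d := Num.min t (Num.min (d1 / 2) (d2 / 2)).
have d0 : 0 < d by rewrite !lt_min tp; lra.
have [e1 e2 e3] : [/\ d <= t, d <= d1 / 2 & d <= d2 / 2].
  by split; rewrite !ge_min lexx ?orbT.
have dn : `|t - (t - d)| = d by rewrite opprB addrC subrK gtr0_norm.
have tdT : 0 <= t - d <= T by lra.
have h1 : `|Y (x, t) - Y (x, t - d)| < e by apply: H1 => //; rewrite dn; lra.
have h2 : `|V (x, t) - V (x, t - d)| < e by apply: H2 => //; rewrite dn; lra.
have := ler_normB (Y (x, t) - Y (x, t - d)) (V (x, t) - V (x, t - d)).
rewrite (before (t - d)); last lra.
rewrite opprB addrA subrK => h3.
by move: h1 h2; rewrite /e (before (t - d)); lra.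
Qed.

(** * The lower contact set *)

Lemma lower_contact_point x1 s : x1 <= l -> 0 <= s <= T ->
  (forall t, 0 <= t <= s -> V (l, t) <= (K2 - k1) + r * (K2 - k1) / (2 * a + b ^+ 2 / r + 1) * (l - x1) ^+ 2) ->
  V (x1, s) = K2 - k1.
Proof.
move=> x1l sT Vl.
have D0 : 0 <= b ^+ 2 / r by apply: divr_ge0 => //; exact: sqr_ge0.
have c0 : 0 < r * (K2 - k1) by apply: mulr_gt0 => //; rewrite subr_gt0.
(* This slope [m] meets the supersolution condition; the [+ 1] keeps its denominator positive even
   if [a] and [b] vanish. *)
apply: (@lower_contact R a b r T s C (K2 - k1) (r * (K2 - k1) / (2 * a + b ^+ 2 / r + 1)) l x1 psi setT setT V) => //.
- lra.
- by apply: divr_ge0; have := a_ge0; lra.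
- have D1 : 0 < 2 * a + b ^+ 2 / r + 1 by have := a_ge0; lra.
  by rewrite mulrAC ler_pdivrMr// ler_pM2l//; lra.
- by move=> y yl; exact: psi1_le_ln.
- by move=> y t _; exact: growthV.
- lra.
Qed.

Lemma uncapped_lower_contact_set t : 0 < t <= T ->
  let S := [set x | x <= l /\ V (x, t) = K2 - k1] in is_max S (sup S).
Proof.
move=> tT S; have tT' : 0 <= t <= T by lra.
have [cV _ _ _ _] := solV.
apply: closed_is_max; last by exists l => x [].
  have -> : S = `]-oo, l] `&` ((fun x => V (x, t)) @^-1` [set K2 - k1]).
    by apply/seteqP; split => x; rewrite /S /= in_itv.
  apply: closedI; first exact: lray_closed.
  have := continuous_section tT' cV.
  by move=> /continuous_closedP; apply; exact: closed_eq.
have D0 : 0 < 2 * a + b ^+ 2 / r + 1.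
  have : 0 <= b ^+ 2 / r by apply: divr_ge0 => //; exact: sqr_ge0.
  by have := a_ge0; lra.
have c0 : 0 < r * (K2 - k1) by apply: mulr_gt0 => //; rewrite subr_gt0.
pose m := r * (K2 - k1) / (2 * a + b ^+ 2 / r + 1).
have m0 : 0 < m by exact: divr_gt0.
pose N := `|C * expR `|l| |.
have N0 : 0 <= N / m by apply: divr_ge0; [exact: normr_ge0|exact: ltW].
(* [N] bounds V(l, .) at all times, and m (n + 1)^2 >= m n = N for n = N / m: the parabola started
   at this distance from [l] dominates V(l, .). *)
exists (l - (N / m + 1)); split; first by lra.
apply: lower_contact_point => //; first by lra.
move=> s st; have -> : l - (l - (N / m + 1)) = N / m + 1 by rewrite opprB addrC subrK.
rewrite -/m; have := growthV l (_ : 0 <= s <= T); rewrite ler_norml => /(_ ltac:(lra)) /andP[_ h].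
apply: (le_trans h); apply: (@le_trans _ _ N); first exact: ler_norm.
have NE : N = m * (N / m) by field; rewrite gt_eqF.
have k2 : 0 < K2 - k1 by rewrite subr_gt0.
rewrite {1}NE; apply: (@le_trans _ _ (m * (N / m + 1) ^+ 2)).
  rewrite ler_pM2l//; set n := N / m in N0 *; nra.
by rewrite lerDr ltW.
Qed.

(** At time 0, V(l, .) equals K2 - k1, and continuity keeps it below K2 - k1 + m e^2 for a while; a
    parabola starting at [l - e] is then enough. *)
Lemma lower_contact_small_time e : 0 < e ->
  exists2 d : R, 0 < d & forall t, 0 < t <= T -> t < d -> V (l - e, t) = K2 - k1.
Proof.
move=> e0; have [cV _ V0 _ _] := solV.
have D0 : 0 < 2 * a + b ^+ 2 / r + 1.
  have : 0 <= b ^+ 2 / r by apply: divr_ge0 => //; exact: sqr_ge0.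
  by have := a_ge0; lra.
have c0 : 0 < r * (K2 - k1) by apply: mulr_gt0 => //; rewrite subr_gt0.
pose m := r * (K2 - k1) / (2 * a + b ^+ 2 / r + 1).
have m0 : 0 < m by exact: divr_gt0.
have me0 : 0 < m * e ^+ 2 by apply: mulr_gt0 => //; exact: exprn_gt0.
have T0 : 0 <= (0 : R) <= T by apply/andP; split; [exact: lexx|exact: ltW].
have [d d0 Hd] := within_segment_near cV (I : setT l) T0 me0.
exists d => // t tT td; apply: lower_contact_point; [lra|lra|].
move=> s st; have -> : l - (l - e) = e by rewrite opprB addrC subrK.
rewrite -/m; have := Hd s; rewrite V0// psi1_le_ln// sub0r normrN ger0_norm ?ltr_norml; last lra.
move=> H; have : - (m * e ^+ 2) < K2 - k1 - V (l, s) < m * e ^+ 2 by apply: H; lra.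
lra.
Qed.

Lemma lower_boundary (A : R -> R) : lower_free_boundary K1 k1 K2 T Y A ->
  exists Ainf : R -> R,
  [/\ lower_free_boundary K1 k1 K2 T V Ainf,
      forall t, 0 <= t <= taus -> A t = Ainf t &
      forall t, 0 < t <= T -> Ainf t <= A t].
Proof.
move=> [Amax Alim].
pose S t := [set x | x <= l /\ V (x, t) = K2 - k1].
(* The value at 0 has to be the limit from the right, which turns out to be [l]. *)
pose Ainf t := if 0 < t then sup (S t) else l.
have maxS t : 0 < t <= T -> is_max (S t) (Ainf t).
  by move=> tT; rewrite /Ainf ifT; [exact: uncapped_lower_contact_set|lra].
have Ainf0 : Ainf 0 = l by rewrite /Ainf ltxx.
have AinfA t : 0 < t <= T -> Ainf t <= A t.
  move=> tT; have [[Al VA] _] := maxS t tT; have [_ ub] := Amax t tT.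
  have tT' : 0 <= t <= T by lra.
  have Ab : Ainf t <= be by apply: le_trans Al (ltW l_lt_be).
  apply: ub; split => //; apply/eqP; rewrite eq_le -{1}VA capped_le_uncapped//=.
  by rewrite -(psi1_le_ln k1 K2 K1_gt0 Al); exact: Ypsi.
(* The sandwich l - e <= Ainf <= A <= l sends both boundaries to [l]; uniqueness of limits then
   identifies [A 0] and settles the coincidence at time 0. *)
have lims e : 0 < e -> \forall t \near (0 : R)^'+, [/\ 0 < t <= T, l - e <= Ainf t, Ainf t <= A t & A t <= l].
  move=> e0; have [d d0 Hd] := lower_contact_small_time e0.
  near=> t; have t0 : 0 < t by near: t; exact: nbhs_right_gt.
  have tT : t <= T by near: t; exact: nbhs_right_le.
  have td : t < d by near: t; exact: nbhs_right_lt.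
  have tT' : 0 < t <= T by rewrite t0.
  split=> //; last by have [[]] := Amax t tT'.
    have [_ ub] := maxS t tT'; apply: ub; split; last exact: Hd.
    by rewrite lerBlDr lerDl ltW.
  exact: AinfA.
have Al : A t @[t --> (0 : R)^'+] --> l.
  apply/cvgrPdist_le => e /lims; apply: filterS => t [_ h1 h2 h3].
  by rewrite ger0_norm; lra.
have Ainfl : Ainf t @[t --> (0 : R)^'+] --> l.
  apply/cvgrPdist_le => e /lims; apply: filterS => t [_ h1 h2 h3].
  by rewrite ger0_norm; lra.
have A0 : A 0 = l by apply: (cvg_unique (@norm_hausdorff _ R) Alim Al).
exists Ainf; split=> //; first by split=> //; rewrite Ainf0.
move=> t /andP[]; rewrite le_eqVlt => /orP[/eqP <- _|t0 ttau]; first by rewrite A0.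
have tT : 0 < t <= T by rewrite t0 (le_trans ttau tau_star_le).
apply: is_max_unique (Amax t tT) _.
suff -> : [set x | x <= ln K1 /\ Y (x, t) = K2 - k1] = S t by exact: maxS.
have YV x : x <= l -> Y (x, t) = V (x, t).
  move=> xl; apply: capped_eq_uncapped; first exact: le_trans xl (ltW l_lt_be).
  by rewrite (ltW t0).
by apply/seteqP; split => x [xl]; [rewrite YV|rewrite -YV].
Unshelve. all: by end_near. Qed.

End FreeBoundaries.

Theorem theorem4p10 (R : realType) (K1 k1 k2 K2 sigma r q T p : R)
    (Y Yinf : R * R -> R) (A B : R -> R)
    (K1_gt0 : 0 < K1) (K1_lt_k1 : K1 < k1) (k1_lt_k2 : k1 < k2)
    (k2_lt_K2 : k2 < K2) (sigma_gt0 : 0 < sigma) (r_gt0 : 0 < r)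
    (q_ge0 : 0 <= q) (T_gt0 : 0 < T) (p_gt1 : 1 < p)
    (Y_solution : capped_strong_solution K1 k1 K2 sigma r q T p Y)
    (Y_bounded : exists M : R, forall x t,
       x <= ln k1 -> 0 <= t <= T -> `|Y (x, t)| <= M)
    (Yinf_solution : uncapped_strong_solution K1 k1 K2 sigma r q T p Yinf)
    (Yinf_growth : exists C : R, forall x t,
       0 <= t <= T -> `|Yinf (x, t)| <= C * expR `|x|)
    (A_boundary : lower_free_boundary K1 k1 K2 T Y A)
    (B_boundary : capped_upper_free_boundary K1 k1 K2 T Y B) :
  let Binf := uncapped_upper_free_boundary K1 k1 K2 Yinf in
  let taus := tau_star k1 T Binf in
  [/\ forall x t, x <= ln k1 -> 0 <= t <= T -> Y (x, t) <= Yinf (x, t),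
      forall t, 0 < t <= T -> (B t)%:E = Order.min (Binf t) (ln k1)%:E,
      forall x t, x <= ln k1 -> 0 <= t <= taus -> Y (x, t) = Yinf (x, t) &
      exists Ainf : R -> R,
        [/\ lower_free_boundary K1 k1 K2 T Yinf Ainf,
            forall t, 0 <= t <= taus -> A t = Ainf t &
            forall t, 0 < t <= T -> Ainf t <= A t]].
Proof.
move=> Binf taus.
have [M HM] := Y_bounded; have [C HC] := Yinf_growth.
have [sY Yb] := Y_solution.
have k1_lt_K2 : k1 < K2 by exact: lt_trans k2_lt_K2.
have k1_gt0 : 0 < k1 by exact: lt_trans K1_lt_k1.
(* The value prescribed at the cap is that of the obstacle, so lateral data are contact data. *)
have psib : psi1 K1 k1 K2 (ln k1) = K2 - K1.
  rewrite psi1_ge_ln//; last by rewrite ler_ln ?posrE// ltW.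
  by rewrite lnK ?posrE//; lra.
have bdY t : 0 <= t <= T -> Y (ln k1, t) = psi1 K1 k1 K2 (ln k1).
  by move=> tT; rewrite psib Yb.
have solY : obstacle_solution (sigma ^+ 2 / 2) (r - q - sigma ^+ 2 / 2) r T (psi1 K1 k1 K2)
    `]-oo, ln k1[ `]-oo, ln k1] Y.
  rewrite -closure_lray; apply: strong_obstacle_solution sY; [exact: ltW|exact: lray_open|].
  move=> x t; rewrite closure_lray /= !in_itv /= => xb /negP; rewrite -leNgt => bx.
  by have -> : x = ln k1 by [apply/eqP; rewrite eq_le xb]; exact: bdY.
have solV : obstacle_solution (sigma ^+ 2 / 2) (r - q - sigma ^+ 2 / 2) r T (psi1 K1 k1 K2)
    setT setT Yinf.
  rewrite -{2}(@closureT R); apply: strong_obstacle_solution Yinf_solution; [exact: ltW|exact: openT|].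
  by move=> x t _ /(_ I).
have a0 : 0 <= sigma ^+ 2 / 2 by apply: divr_ge0 => //; exact: sqr_ge0.
(* The left-hand side is r - q: here the sign of [q] enters. *)
have abr : sigma ^+ 2 / 2 + (r - q - sigma ^+ 2 / 2) <= r by rewrite addrC subrK lerBlDr lerDl.
split.
- by move=> x t; exact: (capped_le_uncapped k1_lt_K2 a0 r_gt0 T_gt0 solY solV bdY HM).
- by move=> t; exact: (upper_boundary K1_gt0 k1_lt_K2 a0 r_gt0 abr T_gt0 solY solV bdY
    HM HC B_boundary).
- by move=> x t; exact: (capped_eq_uncapped K1_gt0 k1_lt_K2 a0 r_gt0 abr T_gt0 solY solV bdY
    HM HC).
- exact: (lower_boundary K1_gt0 K1_lt_k1 k1_lt_K2 a0 r_gt0 abr T_gt0 solY solV bdY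
    HM HC A_boundary).
Qed.
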